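(* Let $F$ be Thompson's group, acting on the dyadic rationals $\mathbb{Z}[\tfrac12]$ and on $D=(0,1)\cap\mathbb{Z}[\tfrac12]$ in the standard ways (specified in the context). For every $n\in\mathbb{N}$, the induced action of $F$ on $\mathscr{P}_n(\mathbb{Z}[\tfrac12])$ is Liouville, and the induced action of $F$ on $\mathscr{P}_n(D)$ is Liouville.
   Context: For a set $X$, $\mathscr{P}_n(X)$ is the set of all $n$-element subsets of $X$; a group acting on $X$ acts on $\mathscr{P}_n(X)$ by $gB=\{gx\mid x\in B\}$. Thompson's group $F$ is the group of all orientation-preserving homeomorphisms of $[0,1]$ that are piecewise affine with finitely many pieces, all break points in $\mathbb{Z}[\tfrac12]$ and all slopes in $\{2^k\mid k\in\mathbb{Z}\}$. It acts on $D=(0,1)\cap\mathbb{Z}[\tfrac12]$ by restriction. It is generated by $\sigma,\tau$ where $\sigma(x)=\tfrac x2$ on $[0,\tfrac12]$, $x-\tfrac14$ on $[\tfrac12,\tfrac34]$, $2x-1$ on $[\tfrac34,1]$; and $\tau(x)=x$ on $[0,\tfrac12]$, $\tfrac x2+\tfrac14$ on $[\tfrac12,\tfrac34]$, $x-\tfrac18$ on $[\tfrac34,\tfrac78]$, $2x-1$ on $[\tfrac78,1]$. $F$ also acts faithfully on $\mathbb{R}$ by orientation-preserving homeomorphisms, the action being determined by letting $\sigma$ act as $x\mapsto x-1$ and $\tau$ act as $x\mapsto x$ on $(-\infty,0]$, $x\mapsto\tfrac x2$ on $[0,2]$, $x\mapsto x-1$ on $[2,\infty)$; this action leaves $\mathbb{Z}[\tfrac12]$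 invariant, which gives the action on $\mathbb{Z}[\tfrac12]$. An action of a countable discrete group $F$ on a set $Y$ is Liouville if there is a probability measure $\mu$ on $F$ that is non-degenerate (its support $\{g\in F\mid\mu(\{g\})>0\}$ generates $F$ as a semigroup) such that every bounded function $f\colon Y\to\mathbb{R}$ with $f(y)=\sum_{g\in F}\mu(\{g\})f(gy)$ for all $y\in Y$ is constant. *)

(* Defs.v *)
From HB Require Import structures.
From mathcomp Require Import all_boot all_order all_algebra.
From mathcomp Require Import all_classical all_reals all_analysis.
From mathcomp Require Import ring lra.

Set Implicit Arguments.
Unset Strict Implicit.
Unset Printing Implicit Defensive.
Import Order.TTheory GRing.Theory Num.Theory.
Import numFieldNormedType.Exports.
Local Open Scope classical_set_scope.
Local Open Scope card_scope.
Local Open Scope ring_scope.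

Section actions.
Context (G : groupType).

(* Left actions; the [action] of the finite group library is a right action of
   a finite group. *)
Record laction (X : Type) := LAction {
  lact :> G -> X -> X;
  lact1 : forall x, lact 1%g x = x;
  lactM : forall g h x, lact (g * h)%g x = lact g (lact h x) }.

Definition lact_invariant X (a : laction X) (A : set X) :=
  forall g x, A x -> A (a g x).

Lemma lact_inj X (a : laction X) g : injective (a g).
Proof.
by apply: (can_inj (g := a (g^-1)%g)) => x; rewrite -lactM mulVg lact1.
Qed.

Section restriction.
Context X (a : laction X) (A : set X) (aA : lact_invariant a A).

Definition restr_fun (g : G) (x : A) : A :=
  exist _ (a g (\val x)) (mem_set (aA g (set_mem (valP x)))).

Lemma restr_fun1 x : restr_fun 1%g x = x.
Proof. by apply: val_inj; rewrite /= lact1. Qed.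

Lemma restr_funM g h x : restr_fun (g * h)%g x = restr_fun g (restr_fun h x).
Proof. by apply: val_inj; rewrite /= lactM. Qed.

Definition restr_laction : laction A := LAction restr_fun1 restr_funM.

End restriction.

Section subsets.
Context X (a : laction X).

Definition set_lact g (B : set X) : set X := a g @` B.

Lemma set_lact1 B : set_lact 1%g B = B.
Proof.
by rewrite /set_lact (_ : a 1%g = id) ?image_id//; apply/funext => x; exact: lact1.
Qed.

Lemma set_lactM g h B : set_lact (g * h)%g B = set_lact g (set_lact h B).
Proof.
rewrite /set_lact image_comp (_ : a (g * h)%g = a g \o a h)//.
by apply/funext => x; exact: lactM.
Qed.

Definition set_laction : laction (set X) := LAction set_lact1 set_lactM.

Definition nsubsets n : set (set X) := [set B | B #= `I_n].

Lemma nsubsets_invariant n : lact_invariant set_laction (nsubsets n).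
Proof.
move=> g B; rewrite /nsubsets /= => Bn; apply: card_eq_trans Bn.
by apply: inj_card_eq => x y _ _; exact: lact_inj.
Qed.

Definition nsubsets_laction n : laction (nsubsets n) :=
  restr_laction (nsubsets_invariant (n := n)).

End subsets.

End actions.

Section liouville.
Context (R : realType) (G : groupType).

Definition discrete := (G : Type).
HB.instance Definition _ := Choice.on discrete.
HB.instance Definition _ := isPointed.Build discrete (1%g : G).
HB.instance Definition _ := @isMeasurable.Build default_measure_display
  discrete discrete_measurable discrete_measurable0
  discrete_measurableC discrete_measurableU.

Definition msupport (mu : probability discrete R) : set G :=
  [set g : G | (0 < mu [set g])%E].

Definition nondegenerate (mu : probability discrete R) : Prop :=
  smallest [set H : set G | forall g h, H g -> H h -> H (g * h)%g]
    (msupport mu) = setT.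

(* The sum of a summable family of arbitrary sign. In [harmonic] the two sums
   are finite because [f] is bounded. *)
Definition signed_esum (T : choiceType) (u : T -> \bar R) : \bar R :=
  (esum [set: T] u^\+ - esum [set: T] u^\-)%E.

Definition harmonic (mu : probability discrete R) Y (a : laction G Y)
    (f : Y -> R) : Prop :=
  forall y, (f y)%:E =
    signed_esum (fun g : G => mu [set g] * (f (a g y))%:E)%E.

Definition liouville Y (a : laction G Y) : Prop :=
  exists2 mu : probability discrete R, nondegenerate mu &
    forall f : Y -> R, (exists M, forall y, `|f y| <= M) ->
      harmonic mu a f -> forall y z, f y = f z.

End liouville.

Section thompson.
Context {R : realType}.
Implicit Types (f g h : R -> R) (x y z p q : R).

Definition dyadic : set R :=
  [set x | exists (m : int) (k : nat), x = m%:~R / 2 ^+ k].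

Definition oriented_homeo f : Prop :=
  [/\ continuous f, exists2 g, continuous g & cancel f g /\ cancel g f
    & {homo f : x y / x < y}].

Definition pow2_affine f p q : Prop :=
  exists (k : int) (c : R), forall x, p <= x <= q -> f x = 2 ^ k * x + c.

(* A homeomorphism of [0,1] fixing 0 and 1 is encoded by its extension to the
   line by the identity, so that equality is equality of functions on R. The
   break points are among the dyadic numbers listed in [s]. *)
Definition is_thompson f : Prop :=
  [/\ oriented_homeo f,
      forall x, ~~ (0 < x < 1) -> f x = x
    & exists2 s : seq R, {in s, forall p, dyadic p} &
        forall p q, 0 <= p -> p < q -> q <= 1 ->
          {in s, forall b, ~~ (p < b < q)} -> pow2_affine f p q].

(* Every strictly increasing surjection of R is a homeomorphism. *)
Lemma oriented_homeoP f g : cancel g f -> {homo f : x y / x < y} ->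
  oriented_homeo f.
Proof.
move=> gf fi.
have fm : {mono f : x y / x <= y} by apply: le_mono.
have cont h k : cancel k h -> {mono h : x y / x <= y} -> continuous h.
  move=> kh hm x.
  have hx : {within `[x - 1, x + 1], continuous h}.
    apply: segment_inc_surj_continuous; first by move=> ? ? _ _; exact: hm.
    move=> y /=; rewrite in_itv /= => /andP[y1 y2]; exists (k y) => //=.
    by rewrite in_itv /= -!(hm _ (k y)) -(hm (k y)) kh y1 y2.
  have xin : x \in `]x - 1, x + 1[ by rewrite in_itv /=; apply/andP; split; lra.
  by apply: (within_continuous_continuous _ hx xin); lra.
have fg : cancel f g by apply: inj_can_sym gf _; exact: (inc_inj fm).
split=> //; first exact: cont gf fm.
exists g; last by [].
by apply: (cont g f) => // x y; rewrite -[in RHS](gf x) -[in RHS](gf y) fm.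
Qed.


Lemma homeo_inv f g : oriented_homeo f -> cancel f g -> cancel g f ->
  oriented_homeo g.
Proof.
case=> fc [g' _ [fg' g'f]] fi fg gf; apply: (oriented_homeoP fg) => x y xy.
have fm : {mono f : x y / x < y} by apply: leW_mono; exact: le_mono.
by rewrite -fm !gf.
Qed.

Lemma dyadicD x y : dyadic x -> dyadic y -> dyadic (x + y).
Proof.
move=> [m [k ->]] [n [l ->]].
exists (m * 2 ^+ l + n * 2 ^+ k), (k + l)%N.
have k0 : (2 : R) ^+ k != 0 by rewrite expf_neq0// pnatr_eq0.
have l0 : (2 : R) ^+ l != 0 by rewrite expf_neq0// pnatr_eq0.
by rewrite exprD intrD !intrM !rmorphXn /=; field; rewrite k0 l0.
Qed.

Lemma dyadicM x y : dyadic x -> dyadic y -> dyadic (x * y).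
Proof.
move=> [m [k ->]] [n [l ->]]; exists (m * n), (k + l)%N.
have k0 : (2 : R) ^+ k != 0 by rewrite expf_neq0// pnatr_eq0.
have l0 : (2 : R) ^+ l != 0 by rewrite expf_neq0// pnatr_eq0.
by rewrite exprD intrM; field; rewrite k0 l0.
Qed.

Lemma dyadic_int (m : int) : dyadic m%:~R.
Proof. by exists m, 0%N; rewrite expr0 divr1. Qed.

Lemma dyadic_nat (m : nat) : dyadic m%:R.
Proof. exact: (dyadic_int m). Qed.

Lemma dyadicN x : dyadic x -> dyadic (- x).
Proof. by move=> dx; rewrite -mulN1r; apply: dyadicM dx; exact: (dyadic_int (-1)). Qed.

Lemma dyadicB x y : dyadic x -> dyadic y -> dyadic (x - y).
Proof. by move=> dx dy; apply: dyadicD => //; exact: dyadicN. Qed.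

Lemma dyadic_pow2 (k : int) : dyadic (2 ^ k).
Proof.
case: k => k.
  by exists (2 ^+ k), 0%N; rewrite expr0 divr1 rmorphXn.
by exists 1, k.+1; rewrite NegzE -exprnN mul1r.
Qed.

Lemma thompson_dyadic f x : is_thompson f -> dyadic x -> dyadic (f x).
Proof.
move=> [_ fid [s sd fs]] dx.
have [x01|/fid->//] := boolP (0 < x < 1).
have f0 : f 0 = 0 by apply: fid; rewrite ltxx.
suff H : forall (s : seq R) p q, {in s, forall b, dyadic b} -> p <= q ->
    (forall p' q', p <= p' -> p' < q' -> q' <= q ->
      {in s, forall b, ~~ (p' < b < q')} -> pow2_affine f p' q') ->
    dyadic p -> dyadic q -> dyadic (f p) -> dyadic (f q).
  have /andP[x0 x1] := x01.
  apply: (H s 0 x sd) => //; first lra.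
  - by move=> p' q' ? ? ? ?; apply: fs => //; lra.
  - exact: (dyadic_nat 0).
  - by rewrite f0; exact: (dyadic_nat 0).
elim=> [|b t IH] p q td pq faff dp dq dfp.
  have [->//|pq'] := eqVneq q p.
  have {}pq : p < q by lra.
  have [//|k [c fE]] := faff p q (lexx _) pq (lexx _).
  have -> : f q = f p + 2 ^ k * (q - p) by rewrite !fE ?lexx ?(ltW pq)//; ring.
  by apply/dyadicD/dyadicM/dyadicB => //; exact: dyadic_pow2.
have db : dyadic b by apply: td; rewrite mem_head.
have td' : {in t, forall b, dyadic b}.
  by move=> z zt; apply: td; rewrite inE zt orbT.
have [/andP[pb bq]|pbq] := boolP (p < b < q).
  apply: (IH b q) => //; first exact: ltW.
    move=> p' q' ? ? ? h; apply: faff => //; first lra.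
    move=> z; rewrite inE => /orP[/eqP->|/h//]; apply/negP => /andP[]; lra.
  apply: (IH p b) => //; first exact: ltW.
  move=> p' q' ? ? ? h; apply: faff => //; first lra.
  move=> z; rewrite inE => /orP[/eqP->|/h//]; apply/negP => /andP[]; lra.
apply: (IH p q) => // p' q' pp' p'q' q'q h; apply: faff => // z.
rewrite inE => /orP[/eqP->|/h//]; apply: contra pbq => /andP[? ?].
by apply/andP; split; lra.
Qed.

Lemma thompson_inv f g : is_thompson f -> cancel f g -> cancel g f ->
  is_thompson g.
Proof.
move=> ft fg gf; have [fh fid [s sd fs]] := ft.
have gh := homeo_inv fh fg gf.
have [_ _ gi] := gh.
have gm : {mono g : x y / x <= y} by apply: le_mono.
have gm' := leW_mono gm.
have gid x : ~~ (0 < x < 1) -> g x = x.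
  by move=> x01; rewrite -[in LHS](fid x x01) fg.
have g0 : g 0 = 0 by apply: gid; rewrite ltxx.
have g1 : g 1 = 1 by apply: gid; rewrite ltxx andbF.
split=> //; exists (map f s).
  by move=> _ /mapP[b bs ->]; exact/thompson_dyadic/sd.
move=> p q p0 pq q1 h.
have [|||b bs|k [c fE]] := fs (g p) (g q).
- by rewrite -g0 gm.
- by rewrite gm'.
- by rewrite -g1 gm.
- by rewrite -[b]fg !gm'; apply: h; exact: map_f.
exists (- k), (- (2 ^ (- k) * c)) => x xpq.
have := fE (g x); rewrite gf !gm xpq => /(_ isT) xE.
have k0 : (2 : R) ^ k != 0 by rewrite expfz_neq0// pnatr_eq0.
by rewrite -invr_expz [in RHS]xE; field.
Qed.

Lemma thompson_comp f g : is_thompson f -> is_thompson g ->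
  is_thompson (f \o g).
Proof.
move=> ft gt; have [[_ [f' _ [ff' f'f]] fi] fid [s sd fs]] := ft.
have [[_ [g' _ [gg' g'g]] gi] gid [t td gs]] := gt.
have gt' := thompson_inv gt gg' g'g.
have gm : {mono g : x y / x <= y} by apply: le_mono.
have gm' := leW_mono gm.
split.
- apply: (@oriented_homeoP _ (g' \o f')) => [x|x y xy] /=; first by rewrite g'g f'f.
  exact/fi/gi.
- by move=> x x01 /=; rewrite gid// fid.
exists (t ++ map g' s).
  move=> b; rewrite mem_cat => /orP[/td//|/mapP[c cs ->]].
  exact/thompson_dyadic/sd.
have g0 : g 0 = 0 by apply: gid; rewrite ltxx.
have g1 : g 1 = 1 by apply: gid; rewrite ltxx andbF.
move=> p q p0 pq q1 h.
have [//|//|//|b bt|k [c gE]] := gs p q; first by apply: h; rewrite mem_cat bt.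
have [|||b bs|l [d fE]] := fs (g p) (g q).
- by rewrite -g0 gm.
- by rewrite gm'.
- by rewrite -g1 gm.
- by rewrite -[b]g'g !gm'; apply: h; rewrite mem_cat (map_f g' bs) orbT.
exists (l + k), (2 ^ l * c + d) => x xpq /=.
rewrite fE ?gm// gE// expfzDr ?pnatr_eq0//.
by rewrite mulrDr mulrA addrA.
Qed.

Lemma thompson_id : is_thompson idfun.
Proof.
split=> //; first exact: (@oriented_homeoP _ idfun).
by exists [::] => // p q _ _ _ _; exists 0, 0 => x _; rewrite expr0z /= mul1r addr0.
Qed.

End thompson.

Local Ltac split_ifs :=
  repeat match goal with |- context [if _ then _ else _] => case: ifPn => ? end.

Section thompson_group.
Context (R : realType).

Record thompson := Thompson {
  thompson_fun :> R -> R;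
  thompsonP : is_thompson thompson_fun }.

HB.instance Definition _ := gen_eqMixin thompson.
HB.instance Definition _ := gen_choiceMixin thompson.

Lemma thompson_ext (f g : thompson) : f =1 g -> f = g.
Proof.
case: f g => [f fP] [g gP] /= /funext fg.
by subst g; congr Thompson; exact: Prop_irrelevance.
Qed.

Lemma thompson_invP (f : thompson) :
  exists g : thompson, cancel f g /\ cancel g f.
Proof.
have [[_ [g _ [fg gf]] _] _ _] := thompsonP f.
by exists (Thompson (thompson_inv (thompsonP f) fg gf)).
Qed.

Definition thompson_one := Thompson (@thompson_id R).
Definition thompson_mul (f g : thompson) :=
  Thompson (thompson_comp (thompsonP f) (thompsonP g)).
Definition thompson_invg (f : thompson) := projT1 (cid (thompson_invP f)).

Lemma thompson_mulA : associative thompson_mul.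
Proof. by move=> f g h; exact: thompson_ext. Qed.

Lemma thompson_mul1 : left_id thompson_one thompson_mul.
Proof. by move=> f; exact: thompson_ext. Qed.

Lemma thompson_mulr1 : right_id thompson_one thompson_mul.
Proof. by move=> f; exact: thompson_ext. Qed.

Lemma thompson_mulV : left_inverse thompson_one thompson_invg thompson_mul.
Proof.
move=> f; apply: thompson_ext => x /=.
by rewrite /thompson_invg; case: cid => g [] /=.
Qed.

Lemma thompson_mulrV : right_inverse thompson_one thompson_invg thompson_mul.
Proof.
move=> f; apply: thompson_ext => x /=.
by rewrite /thompson_invg; case: cid => g [] /=.
Qed.

HB.instance Definition _ := isGroup.Build thompson
  thompson_mulA thompson_mul1 thompson_mulr1 thompson_mulV thompson_mulrV.

Definition thompson_laction : laction thompson R :=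
  @LAction thompson R thompson_fun (fun=> erefl) (fun _ _ _ => erefl).

Definition unit_dyadic : set R := `]0, 1[ `&` dyadic.

Lemma unit_dyadic_invariant : lact_invariant thompson_laction unit_dyadic.
Proof.
move=> g x [/= + dx]; split; last exact: thompson_dyadic (thompsonP g) dx.
have [[_ _ gi] gid _] := thompsonP g.
have g0 : g 0 = 0 by apply: gid; rewrite ltxx.
have g1 : g 1 = 1 by apply: gid; rewrite ltxx andbF.
move: a; rewrite /= !in_itv /= => /andP[x0 x1].
by apply/andP; split; [rewrite -g0 | rewrite -g1]; exact: gi.
Qed.

Definition sigma_fun (x : R) : R :=
  if x <= 0 then x else if 1 <= x then x else
  if x <= 1 / 2 then x / 2 else
  if x <= 3 / 4 then x - 1 / 4 else 2 * x - 1.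

Definition tau_fun (x : R) : R :=
  if x <= 0 then x else if 1 <= x then x else
  if x <= 1 / 2 then x else
  if x <= 3 / 4 then x / 2 + 1 / 4 else
  if x <= 7 / 8 then x - 1 / 8 else 2 * x - 1.

Implicit Types x : R.

Lemma sigma_funE1 x : 0 <= x -> x <= 1 / 2 -> sigma_fun x = x / 2.
Proof. by move=> ? ?; rewrite /sigma_fun; split_ifs; lra. Qed.

Lemma sigma_funE2 x : 1 / 2 <= x -> x <= 3 / 4 -> sigma_fun x = x - 1 / 4.
Proof. by move=> ? ?; rewrite /sigma_fun; split_ifs; lra. Qed.

Lemma sigma_funE3 x : 3 / 4 <= x -> x <= 1 -> sigma_fun x = 2 * x - 1.
Proof. by move=> ? ?; rewrite /sigma_fun; split_ifs; lra. Qed.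

Lemma sigma_fun_out x : ~~ (0 < x < 1) -> sigma_fun x = x.
Proof.
rewrite negb_and -!leNgt => /orP[x0|x1]; rewrite /sigma_fun ?x0//.
by rewrite x1; case: ifP.
Qed.

Lemma sigma_fun_inc : {homo sigma_fun : x y / x < y}.
Proof. by move=> x y xy; rewrite /sigma_fun; split_ifs; lra. Qed.

Lemma sigma_surj (y : R) : exists x, sigma_fun x = y.
Proof.
have [y01|y01] := boolP (0 < y < 1); last by exists y; exact: sigma_fun_out.
move: y01 => /andP[y0 y1].
have [h1|/negP h1] := boolP (y <= 1 / 4).
  by exists (2 * y); rewrite sigma_funE1; lra.
have [h2|/negP h2] := boolP (y <= 1 / 2).
  by exists (y + 1 / 4); rewrite sigma_funE2; lra.
by exists ((y + 1) / 2); rewrite sigma_funE3; lra.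
Qed.

Lemma is_thompson_sigma : is_thompson sigma_fun.
Proof.
split; last 1 first.
- exists [:: 1 / 2; 3 / 4].
    move=> b; rewrite !inE => /orP[] /eqP ->.
      by exists 1, 1%N; rewrite expr1.
    by exists 3, 2%N; congr (_ / _); ring.
  move=> p q p0 pq q1 h.
  have := h (1 / 2); have := h (3 / 4).
  rewrite !inE !eqxx orbT /= => /(_ isT) h1 /(_ isT) h2; clear h.
  have [q2|/negP q2] := boolP (q <= 1 / 2).
    exists (- 1), 0 => x /andP[px xq].
    by rewrite -invr_expz expr1z sigma_funE1; lra.
  have [q3|/negP q3] := boolP (q <= 3 / 4).
    exists 0, (- (1 / 4)) => x /andP[px xq].
    by rewrite expr0z sigma_funE2; lra.
  exists 1, (- 1) => x /andP[px xq].
  by rewrite expr1z sigma_funE3; lra.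
- have [g gK] := choice sigma_surj.
  exact: (oriented_homeoP gK sigma_fun_inc).
- exact: sigma_fun_out.
Qed.

Lemma tau_funE1 x : 0 <= x -> x <= 1 / 2 -> tau_fun x = x.
Proof. by move=> ? ?; rewrite /tau_fun; split_ifs; lra. Qed.

Lemma tau_funE2 x : 1 / 2 <= x -> x <= 3 / 4 -> tau_fun x = x / 2 + 1 / 4.
Proof. by move=> ? ?; rewrite /tau_fun; split_ifs; lra. Qed.

Lemma tau_funE3 x : 3 / 4 <= x -> x <= 7 / 8 -> tau_fun x = x - 1 / 8.
Proof. by move=> ? ?; rewrite /tau_fun; split_ifs; lra. Qed.

Lemma tau_funE4 x : 7 / 8 <= x -> x <= 1 -> tau_fun x = 2 * x - 1.
Proof. by move=> ? ?; rewrite /tau_fun; split_ifs; lra. Qed.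

Lemma tau_fun_out x : ~~ (0 < x < 1) -> tau_fun x = x.
Proof.
rewrite negb_and -!leNgt => /orP[x0|x1]; rewrite /tau_fun ?x0//.
by rewrite x1; case: ifP.
Qed.

Lemma tau_fun_inc : {homo tau_fun : x y / x < y}.
Proof. by move=> x y xy; rewrite /tau_fun; split_ifs; lra. Qed.

Lemma tau_surj (y : R) : exists x, tau_fun x = y.
Proof.
have [y01|y01] := boolP (0 < y < 1); last by exists y; exact: tau_fun_out.
move: y01 => /andP[y0 y1].
have [h1|/negP h1] := boolP (y <= 1 / 2).
  by exists (y); rewrite tau_funE1; lra.
have [h2|/negP h2] := boolP (y <= 5 / 8).
  by exists (2 * y - 1 / 2); rewrite tau_funE2; lra.
have [h3|/negP h3] := boolP (y <= 3 / 4).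
  by exists (y + 1 / 8); rewrite tau_funE3; lra.
by exists ((y + 1) / 2); rewrite tau_funE4; lra.
Qed.

Lemma is_thompson_tau : is_thompson tau_fun.
Proof.
split; last 1 first.
- exists [:: 1 / 2; 3 / 4; 7 / 8].
    move=> b; rewrite !inE => /or3P[] /eqP ->.
    - by exists 1, 1%N; rewrite expr1.
    - by exists 3, 2%N; congr (_ / _); ring.
    - by exists 7, 3%N; congr (_ / _); ring.
  move=> p q p0 pq q1 h.
  have := h (1 / 2); have := h (3 / 4); have := h (7 / 8).
  rewrite !inE !eqxx !orbT /= => /(_ isT) h1 /(_ isT) h2 /(_ isT) h3; clear h.
  have [q2|/negP q2] := boolP (q <= 1 / 2).
    exists 0, 0 => x /andP[px xq].
    by rewrite expr0z tau_funE1; lra.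
  have [q3|/negP q3] := boolP (q <= 3 / 4).
    exists (- 1), (1 / 4) => x /andP[px xq].
    by rewrite -invr_expz expr1z tau_funE2; lra.
  have [q4|/negP q4] := boolP (q <= 7 / 8).
    exists 0, (- (1 / 8)) => x /andP[px xq].
    by rewrite expr0z tau_funE3; lra.
  exists 1, (- 1) => x /andP[px xq].
  by rewrite expr1z tau_funE4; lra.
- have [g gK] := choice tau_surj.
  exact: (oriented_homeoP gK tau_fun_inc).
- exact: tau_fun_out.
Qed.

Definition sigma := Thompson is_thompson_sigma.
Definition tau := Thompson is_thompson_tau.

(* As sigma and tau generate the group, at most one action qualifies; one does,
   by [standard_line_action_exists] below. *)
Record standard_line_action (a : laction thompson R) : Prop := {
  line_homeo : forall g, oriented_homeo (a g);
  line_sigma : forall x, a sigma x = x - 1;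
  line_tau : forall x, a tau x =
    if x <= 0 then x else if x <= 2 then x / 2 else x - 1;
  line_dyadic : lact_invariant a dyadic }.

End thompson_group.

(* A standard action exists: conjugate the action on ]0,1[ by the piecewise
   affine homeomorphism from R to ]0,1[ that maps k to 1 - 2^-(k+1) and -k to
   2^-(k+1) for k : nat and is affine between consecutive integers. *)
Section line_action_exists.
Context (R : realType).
Implicit Types (x y : R) (g : thompson R).

Definition half_chart x : R :=
  1 - (2 - (x - (Num.truncn x)%:R)) / 2 ^+ (Num.truncn x).+2.

Definition chart x : R := if 0 <= x then half_chart x else 1 - half_chart (- x).

Lemma half_chart_small x : 0 <= x -> x < 1 -> half_chart x = 1 / 2 + x / 4.
Proof.
move=> x0 x1; have tx : Num.truncn x = 0%N by apply: truncn_def; lra.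
by rewrite /half_chart tx; field.
Qed.

Lemma half_chartS x : 0 <= x -> half_chart (x + 1) = (1 + half_chart x) / 2.
Proof.
move=> x0.
have tx : Num.truncn (x + 1) = (Num.truncn x).+1.
  apply: truncn_def; have := truncn_itv x0; rewrite -!natr1; lra.
rewrite /half_chart tx exprS -[_.+1%:R]natr1.
have k0 : (2 : R) ^+ (Num.truncn x).+2 != 0 by rewrite expf_neq0// pnatr_eq0.
by field.
Qed.

Lemma half_chart_itv x : 0 <= x -> 1 / 2 <= half_chart x < 1.
Proof.
have H n : forall x, 0 <= x -> x < n%:R -> 1 / 2 <= half_chart x < 1.
  elim: n => [|n IH] y y0; first by move=> ?; lra.
  rewrite -natr1 => yn.
  have [y1|/negP y1] := boolP (y < 1); first by rewrite half_chart_small//; lra.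
  have := half_chartS (_ : 0 <= y - 1); rewrite subrK => ->; last lra.
  by have := IH (y - 1); lra.
move=> x0; apply: (H (Num.truncn x).+1) => //.
by have := truncn_itv x0; lra.
Qed.

Lemma half_chart_inc x y : 0 <= x -> x < y -> half_chart x < half_chart y.
Proof.
have H n : forall x y, 0 <= x -> x < n%:R -> x < y ->
    half_chart x < half_chart y.
  elim: n => [|n IH] {}x {}y x0; first by move=> ?; lra.
  rewrite -natr1 => xn xy.
  have [x1|/negP x1] := boolP (x < 1).
    rewrite half_chart_small//.
    have [y1|/negP y1] := boolP (y < 1); first by rewrite half_chart_small//; lra.
    have := half_chartS (_ : 0 <= y - 1); rewrite subrK => ->; last lra.
    by have := @half_chart_itv (y - 1); lra.
  have := half_chartS (_ : 0 <= y - 1); rewrite subrK => ->; last lra.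
  have := half_chartS (_ : 0 <= x - 1); rewrite subrK => ->; last lra.
  by have := IH (x - 1) (y - 1); lra.
move=> x0; apply: (H (Num.truncn x).+1) => //.
by have := truncn_itv x0; lra.
Qed.

Lemma half_chart0 : half_chart 0 = 1 / 2.
Proof. by rewrite half_chart_small//; lra. Qed.

Lemma half_chart_dyadic x : dyadic x -> dyadic (half_chart x).
Proof.
move=> dx; apply: dyadicB; first exact: (dyadic_nat 1).
apply: dyadicM; last first.
  by have := @dyadic_pow2 R (Negz (Num.truncn x).+1).
apply: dyadicB; first exact: (dyadic_nat 2).
by apply: dyadicB => //; exact: dyadic_nat.
Qed.

Lemma half_chart_surj y : 1 / 2 <= y -> y < 1 ->
  exists x, [/\ 0 <= x, half_chart x = y & dyadic y -> dyadic x].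
Proof.
have H n : forall y, 1 / 2 <= y -> (n%:R + 1) * (1 - y) >= 1 / 2 -> y < 1 ->
  exists x, [/\ 0 <= x, half_chart x = y & dyadic y -> dyadic x].
  elim: n => [|n IH] {}y y2 yn y1.
    exists 0; rewrite half_chart0; split=> //; first lra.
    by move=> _; exact: (dyadic_nat 0).
  have [y3|/negP y3] := boolP (y < 3 / 4).
    exists (4 * y - 2); rewrite half_chart_small; [|lra..].
    split; [lra|lra|move=> dy].
    by apply: dyadicB (dyadicM (@dyadic_nat R 4) dy) (@dyadic_nat R 2).
  have [|||x [x0 xy dx]] := IH (2 * y - 1); [lra| |lra|].
    move: yn; rewrite -natr1 => yn.
    have : 0 <= n%:R * (1 - y) by rewrite mulr_ge0//; lra.
    by lra.
  exists (x + 1); rewrite half_chartS// xy; split; [lra|lra|move=> dy].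
  apply: dyadicD; last exact: (dyadic_nat 1).
  by apply: dx; exact: dyadicB (dyadicM (@dyadic_nat R 2) dy) (@dyadic_nat R 1).
move=> y2 y1; apply: (H (Num.truncn (1 - y)^-1)) => //.
have y0 : 0 < 1 - y by lra.
have := @truncn_itv _ (1 - y)^-1; rewrite invr_ge0 => /(_ (ltW y0)) /andP[_].
rewrite -natr1 -(ltr_pM2r y0) mulVf ?gt_eqF//; lra.
Qed.

Lemma chart_inc : {homo chart : x y / x < y}.
Proof.
move=> x y xy; rewrite /chart.
case: ifPn => x0; case: ifPn => y0; first exact: half_chart_inc.
- by exfalso; lra.
- have := @half_chart_inc 0 (- x); rewrite half_chart0.
  by have := half_chart_itv y0; lra.
- by have := @half_chart_inc (- y) (- x); lra.
Qed.

Lemma chart_itv x : 0 < chart x < 1.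
Proof.
rewrite /chart; case: ifPn => x0; first by have := half_chart_itv x0; lra.
by have := @half_chart_itv (- x); lra.
Qed.

Lemma chart_dyadic x : dyadic x -> dyadic (chart x).
Proof.
move=> dx; rewrite /chart; case: ifP => _; first exact: half_chart_dyadic.
apply: dyadicB; first exact: (dyadic_nat 1).
exact/half_chart_dyadic/dyadicN.
Qed.

Lemma chart_surj y :
  exists x, 0 < y < 1 -> chart x = y /\ (dyadic y -> dyadic x).
Proof.
have [y01|y01] := boolP (0 < y < 1); last by exists 0.
have [y2|/negP y2] := boolP (1 / 2 <= y).
  have [||x [x0 xy dx]] := @half_chart_surj y; [lra..|].
  by exists x => _; rewrite /chart x0.
have [||x [x0 xy dx]] := @half_chart_surj (1 - y); [lra..|].
exists (- x) => _; rewrite /chart opprK.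
have xn0 : x != 0 by apply/eqP => xE; move: xy; rewrite xE half_chart0; lra.
rewrite ifF; last by apply/negbTE; rewrite -ltNge; lra.
split; first by rewrite xy; lra.
by move=> dy; apply/dyadicN/dx/dyadicB => //; exact: (dyadic_nat 1).
Qed.

Lemma chart_sigma x : sigma_fun (chart x) = chart (x - 1).
Proof.
rewrite /chart; have [x0|/negP x0] := boolP (0 <= x); last first.
  rewrite ifF; last by apply/negbTE; rewrite -ltNge; lra.
  have -> : - (x - 1) = - x + 1 by lra.
  have xn : 0 <= - x by lra.
  by have := half_chart_itv xn => ?; rewrite half_chartS// sigma_funE1; lra.
have [x1|/negP x1] := boolP (0 <= x - 1).
  have := half_chartS x1; rewrite subrK => ->.
  by have := half_chart_itv x1 => ?; rewrite sigma_funE3; lra.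
rewrite half_chart_small ?sigma_funE2; [|lra..].
have [->|xn0] := eqVneq x 0.
  have -> : - (0 - 1) = 0 + 1 :> R by lra.
  by rewrite half_chartS// half_chart0; lra.
by rewrite half_chart_small; lra.
Qed.

Lemma chart_tau x : tau_fun (chart x) =
  chart (if x <= 0 then x else if x <= 2 then x / 2 else x - 1).
Proof.
have [x0|/negP x0] := boolP (x <= 0).
  have := chart_itv x; have [->|xn0] := eqVneq x 0.
    by rewrite /chart lexx half_chart0 => ?; rewrite tau_funE1; lra.
  rewrite /chart ifF; last by apply/negbTE; rewrite -ltNge; lra.
  have xn : 0 <= - x by lra.
  by have := half_chart_itv xn => ? ?; rewrite tau_funE1; lra.
have [x2|/negP x2] := boolP (x <= 2); last first.
  have x3 : 0 <= x - 1 - 1 by lra.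
  rewrite /chart !ifT; [|lra..].
  have := half_chartS (_ : 0 <= x - 1); rewrite subrK => ->; last lra.
  have := half_chartS x3; rewrite subrK => ->.
  by have := half_chart_itv x3 => ?; rewrite tau_funE4; lra.
rewrite /chart !ifT; [|lra..].
have [x1|/negP x1] := boolP (x < 1).
  by rewrite !half_chart_small ?tau_funE2; lra.
have x3 : 0 <= x - 1 by lra.
have := half_chartS x3; rewrite subrK => ->.
have [xE|xn2] := eqVneq x 2.
  have -> : x - 1 = 0 + 1 by lra.
  have -> : x / 2 = 0 + 1 by lra.
  by rewrite half_chartS// half_chart0 tau_funE3; lra.
by rewrite !half_chart_small ?tau_funE3; lra.
Qed.

Lemma thompson_itv g x : 0 < x < 1 -> 0 < g x < 1.
Proof.
move=> /andP[x0 x1]; have [[_ _ gi] gid _] := thompsonP g.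
have g0 : g 0 = 0 by apply: gid; rewrite ltxx.
have g1 : g 1 = 1 by apply: gid; rewrite ltxx andbF.
by apply/andP; split; [rewrite -g0 | rewrite -g1]; exact: gi.
Qed.

Lemma standard_line_action_exists :
  exists a : laction (thompson R) R, standard_line_action a.
Proof.
have [h hP] := choice chart_surj.
have chartm : {mono chart : x y / x < y}.
  by apply: leW_mono; apply: le_mono; exact: chart_inc.
have chart_inj : injective chart.
  by apply: inc_inj; apply: le_mono; exact: chart_inc.
have hK y : 0 < y < 1 -> chart (h y) = y by move=> /hP[].
have chartK x : h (chart x) = x by apply: chart_inj; rewrite hK// chart_itv.
have gchart g x : chart (h (g (chart x))) = g (chart x).
  by rewrite hK//; exact/thompson_itv/chart_itv.
have a1 x : h ((1%g : thompson R) (chart x)) = x by exact: chartK.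
have aM g k x : h ((g * k)%g (chart x)) = h (g (chart (h (k (chart x))))).
  by rewrite gchart.
pose a : laction (thompson R) R :=
  @LAction (thompson R) R (fun g x => h (g (chart x))) a1 aM.
exists a; split.
- move=> g; apply: (oriented_homeoP (g := a (g^-1)%g)) => [x|x y xy].
    by rewrite -lactM mulgV lact1.
  rewrite -chartm /= !gchart.
  by have [[_ _ gi] _ _] := thompsonP g; apply: gi; exact: chart_inc.
- by move=> x; apply: chart_inj; rewrite gchart; exact: chart_sigma.
- by move=> x; apply: chart_inj; rewrite gchart; exact: chart_tau.
- move=> g x dx /=; have [_] := hP _ (thompson_itv g (chart_itv x)); apply.
  exact: thompson_dyadic (thompsonP g) (chart_dyadic dx).
Qed.

End line_action_exists.

(* Main.v *)
Require Import Defs.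
From HB Require Import structures.
From mathcomp Require Import all_boot all_order all_algebra finmap.
From mathcomp Require Import all_classical all_reals all_analysis.
From mathcomp Require Import ring lra.

(** A Kaimanovich-Vershik construction reduces the theorem to the following: for
    finitely many [n]-subsets, some finitely supported probability [nu] on the
    group makes the laws of [g B], for [g] drawn from [nu], nearly equal for all of
    them. The measure is then a mixture of such [nu_k], each equalizing all points
    that short products of earlier draws can reach.
    Such [nu] exist by induction on [n]: a draw for the [n]-subsets obtained by
    deleting the largest points is followed by a draw after which the largest
    point is forgotten, its law given the other points being nearly independent of
    where it was. The latter draw is composed of long random powers of elements
    fixing the points to the left and moving each of the finitely many relevant
    points on the right to the next one; these exist since
    sigma and tau generate a group that acts transitively on increasing tuples of
    dyadic numbers. Only elements of that group are needed, so an action on the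
    line is used through the images of sigma and tau alone. *)

Set Implicit Arguments.
Unset Strict Implicit.
Unset Printing Implicit Defensive.
Import Order.TTheory GRing.Theory Num.Theory.
Import numFieldNormedType.Exports.
Local Open Scope classical_set_scope.
Local Open Scope ring_scope.

(** * Mixtures of uniform measures *)

Section mixture.
Context (R : realType) (G : groupType) (s : nat -> seq G).
Hypothesis s_nonempty : forall k, (0 < size (s k))%N.
Implicit Types (h : G -> R) (k : nat) (g : G).

(** Lists stand for finitely supported laws with rational weights: an entry counts with its
    multiplicity. *)
Definition avg k h : R := (\sum_(g <- s k) h g) / (size (s k))%:R.

Let size_gt0 k : 0 < (size (s k))%:R :> R.
Proof. by rewrite ltr0n. Qed.

Lemma avg_ge0 k h : (forall g, 0 <= h g) -> 0 <= avg k h.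
Proof. by move=> h0; rewrite divr_ge0// sumr_ge0. Qed.

Lemma avg_cst k (M : R) : avg k (fun=> M) = M.
Proof.
rewrite /avg big_const_seq count_predT iter_addr addr0 -[M *+ _]mulr_natr mulfK//.
by rewrite gt_eqF.
Qed.

Lemma ler_avg k h1 h2 : {in s k, forall g, h1 g <= h2 g} -> avg k h1 <= avg k h2.
Proof.
move=> h12; rewrite ler_wpM2r ?invr_ge0//.
by rewrite big_seq [leRHS]big_seq ler_sum.
Qed.

Lemma avgB k h1 h2 : avg k (fun g => h1 g - h2 g) = avg k h1 - avg k h2.
Proof. by rewrite /avg sumrB mulrBl. Qed.

Definition weight k : R := 2 ^- k.+1.

Lemma weight_ge0 k : 0 <= weight k.
Proof. by rewrite invr_ge0 exprn_ge0. Qed.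

Lemma sum_weight j : \sum_(0 <= k < j) weight k = 1 - 2 ^- j.
Proof.
elim: j => [|j IH]; first by rewrite big_geq// expr0 invr1 subrr.
rewrite big_nat_recr//= IH /weight exprS.
have j0 : (2 : R) ^+ j != 0 by rewrite expf_neq0.
by field.
Qed.

(** A series of scaled sums of Dirac masses, hence a measure by construction; the uniform law on
    [s k] gets mass [weight k]. *)
Definition mixture_pre : set (discrete G) -> \bar R :=
  mseries (fun k => mscale (NngNum (divr_ge0 (weight_ge0 k) (ltW (size_gt0 k))))
    (msum (fun i => \d_(nth 1%g (s k) i : discrete G)) (size (s k)))) 0.

HB.instance Definition _ := Measure.on mixture_pre.

Lemma mixture_preE (A : set G) :
  mixture_pre A = (\sum_(k <oo) (weight k * avg k (fun g => \1_A g))%:E)%E.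
Proof.
rewrite /mixture_pre /= /mseries /=; apply: eq_eseriesr => k _.
rewrite /mscale /= /msum /= /dirac sumEFin -EFinM; congr (_%:E).
rewrite /avg.
by rewrite [in RHS](big_nth 1%g) big_mkord mulrAC mulrA.
Qed.

Lemma is_cvg_mixture h : (forall g, 0 <= h g) ->
  cvgn (fun n => \sum_(0 <= k < n) (weight k * avg k h)%:E)%E.
Proof.
move=> h0; apply: is_cvg_nneseries => n _ _.
by rewrite lee_fin mulr_ge0 ?weight_ge0 ?avg_ge0.
Qed.

Lemma mixture_pre1 : mixture_pre setT = 1%E.
Proof.
rewrite mixture_preE; apply/cvg_lim => //.
have -> : (fun n => \sum_(0 <= k < n) (weight k * avg k (\1_setT : G -> R))%:E)%E =
    EFin \o (fun n => 1 - 2^-1 ^+ n).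
  apply/funext => n /=; rewrite sumEFin; congr (_%:E).
  rewrite exprVn -sum_weight; apply: eq_bigr => k _.
  rewrite (_ : \1_setT = fun=> 1) ?avg_cst ?mulr1//.
  by apply/funext => g; rewrite indicE in_setT.
apply/cvg_EFin; first by apply: nearW.
rewrite -[X in _ --> X]subr0; apply: cvgB; first exact: cvg_cst.
by apply: cvg_expr; rewrite ger0_norm; lra.
Qed.

HB.instance Definition _ :=
  Measure_isProbability.Build _ _ _ mixture_pre mixture_pre1.

Definition mixture : probability (discrete G) R := mixture_pre.

Lemma mixture_support k g : g \in s k -> msupport mixture g.
Proof.
move=> gs; rewrite /msupport /= [X in (_ < X)%E]mixture_preE.
have nn i : (0 <= (weight i * avg i (fun g' : G => \1_[set g] g' : R))%:E)%E.
  by rewrite lee_fin mulr_ge0 ?weight_ge0// avg_ge0// => g'; rewrite indicE.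
apply: lt_le_trans (nneseries_lim_ge k.+1 (fun i _ _ => nn i)).
rewrite big_nat_recr//=; apply: lt_le_trans (leeDr _ _); last first.
  by apply: sume_ge0 => i _; exact: nn.
rewrite lte_fin; apply: mulr_gt0.
  by rewrite invr_gt0 exprn_gt0.
rewrite divr_gt0//; have /(nthP 1%g)[i ik <-] := gs.
rewrite (big_nth 1%g) big_mkord (bigD1 (Ordinal ik))//=.
by rewrite indicE mem_set// ltr_pwDl ?ltr01// sumr_ge0// => j _; rewrite indicE.
Qed.

(** Tonelli for nonnegative terms: expanding the mass of each singleton gives a double sum over [G]
    and the stages, and after the exchange each list entry contributes at a single group element. *)
Lemma esum_mixture h : (forall g, 0 <= h g) ->
  (\esum_(g in [set: G]) (mixture [set g] * (h g)%:E) =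
   \sum_(k <oo) (weight k * avg k h)%:E)%E.
Proof.
move=> h0.
have t0 k g : (0 <= (weight k * avg k (fun g' => h g' * \1_[set g] g'))%:E)%E.
  by rewrite lee_fin mulr_ge0 ?weight_ge0// avg_ge0// => g'; rewrite mulr_ge0// indicE.
transitivity (\esum_(g in [set: G]) \esum_(k in [set: nat])
    (weight k * avg k (fun g' => h g' * \1_[set g] g'))%:E)%E.
  apply: eq_esum => g _; rewrite [X in (X * _)%E]mixture_preE muleC -nneseriesZl; last first.
    by move=> i _; rewrite lee_fin mulr_ge0 ?weight_ge0// avg_ge0.
  rewrite -nneseries_esumT//; apply: eq_eseriesr => k _.
  rewrite -EFinM; congr (_%:E); rewrite mulrCA; congr (_ * _).
  rewrite /avg mulrA mulr_sumr; congr (_ / _); apply: eq_bigr => g' _.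
  by rewrite !indicE; case: (boolP (g' \in _)); rewrite ?mulr0// inE => ->.
rewrite esum_esum//.
rewrite (reindex_esum ([set: nat] `*`` (fun=> [set: G])) _
  (fun x => (x.2, x.1)))//=; last first.
  split=> //=; first by move=> [i1 i2] [j1 j2] /= _ _ [-> ->].
  by move=> [i j] _; exists (j, i).
rewrite -(esum_esum (J := fun=> setT) (a := fun k g =>
  (weight k * avg k (fun g' => h g' * \1_[set g] g'))%:E)); last by move=> *; exact: t0.
rewrite -nneseries_esumT; last by move=> k; exact: esum_ge0.
apply: eq_eseriesr => k _.
under eq_esum => g _.
  rewrite /avg mulr_suml mulr_sumr -sumEFin; over.
rewrite esum_sum; last first.
  move=> g g' _ _; rewrite lee_fin mulr_ge0 ?weight_ge0// divr_ge0//.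
  by rewrite mulr_ge0// indicE.
rewrite /avg mulr_suml mulr_sumr -sumEFin; apply: eq_bigr => g' _.
rewrite -(@esum_set1 _ _ g' (fun=> (weight k * (h g' / (size (s k))%:R))%:E)); last first.
  by rewrite lee_fin mulr_ge0 ?weight_ge0// divr_ge0.
rewrite [RHS]esum_mkcond; apply: eq_esum => g _.
rewrite indicE; have [->|gg'] := eqVneq g g'; first by rewrite !mem_set//= mulr1.
by rewrite !memNset ?mulr0 ?mul0r ?mulr0// => /= E; case/eqP: gg'; rewrite E.
Qed.

Lemma mixture_esum_cvg h M : (forall g, 0 <= h g <= M) ->
  exists2 r, (\esum_(g in [set: G]) (mixture [set g] * (h g)%:E) = r%:E)%E &
    (fun n => \sum_(0 <= k < n) weight k * avg k h) @ \oo --> r.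
Proof.
move=> hM; have h0 g : 0 <= h g by have /andP[] := hM g.
have M0 : 0 <= M by have /andP[/le_trans] := hM 1%g; apply.
have c := is_cvg_mixture h0.
have u n : (\sum_(0 <= k < n) (weight k * avg k h)%:E <= M%:E)%E.
  rewrite sumEFin lee_fin; apply: (@le_trans _ _ (\sum_(0 <= k < n) weight k * M)).
    apply: ler_sum => k _; rewrite ler_wpM2l ?weight_ge0//.
    by rewrite -[leRHS](avg_cst k); apply: ler_avg => g _; have /andP[] := hM g.
  rewrite -mulr_suml sum_weight ler_piMl// gerBl invr_ge0 exprn_ge0//.
have : (\sum_(k <oo) (weight k * avg k h)%:E)%E \is a fin_num.
  rewrite ge0_fin_numE; last first.
    by apply: nneseries_ge0 => k _ _; rewrite lee_fin mulr_ge0 ?weight_ge0 ?avg_ge0.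
  apply: (@le_lt_trans _ _ M%:E); last exact: ltry.
  by apply: lime_le => //; apply: nearW.
move=> /fineK rE; exists (fine (\sum_(k <oo) (weight k * avg k h)%:E)%E).
  by rewrite rE; exact: esum_mixture.
rewrite (_ : (fun n => _) = fine \o (fun n => \sum_(0 <= k < n) (weight k * avg k h)%:E)%E).
  by apply/fine_cvg; rewrite rE.
by apply/funext => n /=; rewrite sumEFin.
Qed.

(** The positive and negative parts of [h] are bounded, so both unsigned sums are finite and can be
    subtracted. Harmonicity thereby becomes a limit of real partial sums over the stages. *)
Lemma signed_esum_mixture h M : (forall g, `|h g| <= M) -> forall r : R,
  r%:E = signed_esum (fun g : G => mixture [set g] * (h g)%:E)%E ->
  (fun n => \sum_(0 <= k < n) weight k * avg k h) @ \oo --> r.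
Proof.
move=> hM r; rewrite /signed_esum.
have fin g : exists2 p, 0 <= p & mixture [set g] = p%:E.
  exists (fine (mixture [set g])); first exact: fine_ge0.
  by rewrite fineK// fin_num_measure.
have [|p pE pc] := @mixture_esum_cvg (fun g => Num.max (h g) 0) M.
  move=> g; have := hM g; rewrite ler_norml => /andP[? ?].
  by rewrite le_max lexx orbT ge_max; apply/andP; split => //; lra.
have [|q qE qc] := @mixture_esum_cvg (fun g => Num.max (- h g) 0) M.
  move=> g; have := hM g; rewrite ler_norml => /andP[? ?].
  by rewrite le_max lexx orbT ge_max; apply/andP; split => //; lra.
rewrite (_ : esum _ _ = p%:E); last first.
  rewrite -pE; apply: eq_esum => g _; rewrite funeposE.
  have [w w0 ->] := fin g.
  by rewrite -!EFinM -EFin_max; congr (_%:E); rewrite maxr_pMr// mulr0.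
rewrite (_ : esum _ _ = q%:E); last first.
  rewrite -qE; apply: eq_esum => g _; rewrite funenegE.
  have [w w0 ->] := fin g.
  by rewrite -!EFinM -EFinN -EFin_max; congr (_%:E); rewrite -mulrN maxr_pMr// mulr0.
rewrite -EFinB => -[->].
rewrite (_ : (fun n => _) = (fun n =>
    \sum_(0 <= k < n) weight k * avg k (fun g => Num.max (h g) 0) -
    \sum_(0 <= k < n) weight k * avg k (fun g => Num.max (- h g) 0))).
  exact: cvgB.
apply/funext => n; rewrite -sumrB; apply: eq_bigr => k _.
rewrite -mulrBr -avgB; congr (_ * avg _ _); apply/funext => g.
by rewrite /Num.max; case: ifPn; case: ifPn; lra.
Qed.

End mixture.

(** * A criterion for the Liouville property *)

Section criterion.
Context (R : realType) (G : groupType) (Y : Type) (a : laction G Y).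
Implicit Types (eps M : R) (s W : seq G) (y z : Y) (g w : G).

(** The dual form of total variation: for [g] uniform on [s], the laws of [a g y] and [a g z] are at
    [L^1] distance at most [eps]. The size of [s] is multiplied out. *)
Definition equalizes eps s y z : Prop :=
  forall (f : Y -> R) M, (forall y, `|f y| <= M) ->
    `|\sum_(g <- s) f (a g y) - \sum_(g <- s) f (a g z)| <= eps * M * (size s)%:R.

(** Repeating [s] many times makes one extra entry negligible. This is how every group element
    enters the support, for non-degeneracy. *)
Lemma equalizes_adjoin eps s g (P : Y -> Y -> Prop) : 0 < eps -> (0 < size s)%N ->
  (forall y z, P y z -> equalizes (eps / 2) s y z) ->
  exists2 s', g \in s' & forall y z, P y z -> equalizes eps s' y z.
Proof.
move=> e0 s0 sP.
have [N e4] : exists N, 4 <= N%:R * eps.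
  exists (Num.truncn (4 / eps)).+1; rewrite -ler_pdivrMr//; apply/ltW.
  by have /andP[] := @truncn_itv _ (4 / eps) (divr_ge0 (ler0n _ _) (ltW e0)).
exists (g :: flatten (nseq N s)); first exact: mem_head.
move=> y z /sP yz f M fM.
have M0 : 0 <= M by apply: le_trans (fM y).
have sumN h n : \sum_(i <- flatten (nseq n s)) h i = n%:R * \sum_(i <- s) h i :> R.
  elim: n => [|n IH]; first by rewrite big_nil mul0r.
  by rewrite /= big_cat/= IH -nat1r mulrDl mul1r.
have szN n : size (flatten (nseq n s)) = (n * size s)%N.
  by elim: n => //= n IH; rewrite size_cat IH mulSn.
rewrite !big_cons !sumN /= szN -nat1r natrM.
have s1 : 1 <= (size s)%:R :> R by rewrite ler1n.
have := yz f M fM.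
set A := \sum_(g <- s) _; set B := \sum_(g <- s) _ => AB.
have -> : f (a g y) + N%:R * A - (f (a g z) + N%:R * B) =
  (f (a g y) - f (a g z)) + N%:R * (A - B) by ring.
have N0 : 0 <= N%:R :> R by [].
apply: le_trans (ler_normD _ _) _.
rewrite normrM (ger0_norm N0).
apply: (@le_trans _ _ ((M + M) + N%:R * (eps / 2 * M * (size s)%:R))).
  apply: lerD; last exact: ler_wpM2l.
  by apply: le_trans (ler_normB _ _) _; exact: lerD.
have : 4 * M <= (N%:R * eps) * M * (size s)%:R.
  rewrite -[leLHS]mulr1; apply: ler_pM => //; first by rewrite mulr_ge0.
  by rewrite ler_wpM2r.
have : 0 <= eps * M by rewrite mulr_ge0// ltW.
by lra.
Qed.

Definition ball A m W : seq G :=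
  iter m (fun W => W ++ [seq (g * w)%g | g <- A, w <- W]) W.

Lemma mem_ballS A m W g w : g \in A -> w \in ball A m W ->
  (g * w)%g \in ball A m.+1 W.
Proof. by move=> gA wW; rewrite /= mem_cat allpairs_f ?orbT. Qed.

Lemma sub_ball A B m n V W : {subset A <= B} -> (m <= n)%N -> {subset V <= W} ->
  {subset ball A m V <= ball B n W}.
Proof.
move=> AB mn VW w; elim: m n mn w => [|m IH] n mn w.
  by move=> /VW wW; elim: n {mn} => // n IH; rewrite mem_cat IH.
case: n mn => // n mn; rewrite !mem_cat => /orP[/IH->//|].
by case/allpairsP => -[g v] /= [gA vV ->]; rewrite allpairs_f ?orbT ?AB ?IH.
Qed.

Lemma bernoulli_expr (x : R) n : 0 <= x <= 1 -> (1 - x) ^+ n * (1 + n%:R * x) <= 1.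
Proof.
move=> /andP[x0 x1]; elim: n => [|n IH]; first by rewrite expr0 mul0r addr0 mulr1.
apply: le_trans IH; rewrite exprSr -mulrA; apply: ler_wpM2l.
  by rewrite exprn_ge0// subr_ge0.
rewrite -natr1; have : 0 <= (n%:R + 1) * x ^+ 2 by rewrite mulr_ge0// exprn_ge0.
by rewrite expr2; lra.
Qed.

(** Bernoulli's inequality at [x = 2 ^- j], as [4 ^ j * 2 ^- j = 2 ^ j]. A draw comes from a stage
    below [j] with probability [1 - 2 ^- j], so among [4 ^ j] draws one from a later stage is
    likely. *)
Lemma exp_decay j : (1 - 2 ^- j) ^+ (4 ^ j) <= 2 ^- j :> R.
Proof.
have j0 : 0 < (2 : R) ^+ j by rewrite exprn_gt0.
have j1 : (2 : R) ^- j <= 1 by rewrite invf_le1// exprn_ege1// ler1n.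
have := @bernoulli_expr (2 ^- j) (4 ^ j).
rewrite invr_ge0 (ltW j0) j1 => /(_ isT).
have -> : (4 ^ j)%:R * 2 ^- j = 2 ^+ j :> R.
  by rewrite (expnMn 2 2 j) natrM natrX -mulrA mulfV ?mulr1// gt_eqF.
move=> H; rewrite -[leRHS]mul1r ler_pdivlMr//; apply: le_trans H.
by apply: ler_wpM2l; [rewrite exprn_ge0// subr_ge0|lra].
Qed.

(** * Construction of the stages *)

Context (enum : nat -> G) (y0 : Y).
Hypothesis enum_surj : forall g, exists k, enum k = g.
Hypothesis y0_orbit : forall y, exists g, a g y0 = y.
Hypothesis equalizable : forall W eps, 0 < eps -> exists2 s, (0 < size s)%N &
  forall w w', w \in W -> w' \in W -> equalizes eps s (a w y0) (a w' y0).

(** A witness in [Type] rather than an existential, since the stages are chosen by recursion. *)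
Lemma stage_spec W k : {s | enum k \in s & forall w w', w \in W -> w' \in W ->
  equalizes (2 ^- k) s (a w y0) (a w' y0)}.
Proof.
apply: cid2.
have e0 : (0 : R) < 2 ^- k by rewrite invr_gt0 exprn_gt0.
have [s s0 sW] := equalizable W (divr_gt0 e0 (ltr0Sn _ 1)).
pose P y z := exists w w', [/\ w \in W, w' \in W, y = a w y0 & z = a w' y0].
have [|s' ks' s'P] := @equalizes_adjoin _ s (enum k) P e0 s0.
  by move=> _ _ [w [w' [wW w'W -> ->]]]; exact: sW.
by exists s' => // w w' wW w'W; apply: s'P; exists w, w'.
Qed.

Definition next_stage W k : seq G := s2val (stage_spec W k).

(** What stage [k] has to equalize. The length [4 ^ k] is the one required by [exp_decay]; the
    starting elements exhaust the group as [k] grows. *)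
Definition words k A := ball A (4 ^ k) (map enum (iota 0 k)).

(** All stages below [k], concatenated. The last one is written out because [stage] is itself
    defined from [letters]. *)
Fixpoint letters k : seq G :=
  if k is k'.+1 then letters k' ++ next_stage (words k' (letters k')) k' else [::].

Definition stage k := next_stage (words k (letters k)) k.

Lemma enum_stage k : enum k \in stage k.
Proof. exact: (s2valP (stage_spec _ k)). Qed.

Lemma stage_equalizes k w w' :
  w \in words k (letters k) -> w' \in words k (letters k) ->
  equalizes (2 ^- k) (stage k) (a w y0) (a w' y0).
Proof. by move=> *; exact: (s2valP' (stage_spec _ k)). Qed.

Lemma sub_letters j k : (j <= k)%N -> {subset letters j <= letters k}.
Proof.
move=> /subnK <-; elim: (k - j)%N => // n IH g /IH gl.
by rewrite addSn /= mem_cat gl.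
Qed.

Lemma stage_letters j k : (k < j)%N -> {subset stage k <= letters j}.
Proof.
by move=> kj g gs; apply: (sub_letters kj); rewrite /= mem_cat gs orbT.
Qed.

Lemma sub_words j k : (j <= k)%N ->
  {subset words j (letters j) <= words k (letters k)}.
Proof.
move=> jk; apply: sub_ball; [exact: sub_letters|by rewrite leq_exp2l|].
move=> g /mapP[i]; rewrite mem_iota => /andP[_ ij] ->; apply: map_f.
by rewrite mem_iota /=; exact: leq_trans jk.
Qed.

Lemma stage_gt0 k : (0 < size (stage k))%N.
Proof. by case: (stage k) (enum_stage k). Qed.

Local Notation mu := (mixture R stage_gt0).

(** * Oscillation of a bounded harmonic function along words *)

Section oscillation.
Context (f : Y -> R) (M : R).
Hypothesis f_le : forall y, `|f y| <= M.
Hypothesis f_harm : Defs.harmonic mu a f.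
Local Notation F w := (f (a w y0)).

Lemma harmonic_cvg w :
  (fun n => \sum_(0 <= k < n) weight R k * avg stage k (fun g => F (g * w)%g)) @ \oo
    --> F w.
Proof.
apply: (@signed_esum_mixture R G stage stage_gt0 (fun g => F (g * w)%g) M) => //.
rewrite f_harm; congr signed_esum; apply/funext => g.
by rewrite lactM.
Qed.

Lemma dist_le_series (w w' : G) (B : nat -> R) (C : R) :
  (forall k, `|avg stage k (fun g => F (g * w)%g) -
              avg stage k (fun g => F (g * w')%g)| <= B k) ->
  (\forall n \near \oo, \sum_(0 <= k < n) weight R k * B k <= C) ->
  `|F w - F w'| <= C.
Proof.
move=> HB HC; pose S w n := \sum_(0 <= k < n) weight R k * avg stage k (fun g => F (g * w)%g).
have H : (fun n => `|S w n - S w' n|) @ \oo --> `|F w - F w'|.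
  by apply: cvg_norm; apply: cvgB; exact: harmonic_cvg.
rewrite -(cvg_lim _ H)//.
apply: limr_le; first by apply/cvg_ex; eexists; exact: H.
near=> n; apply: le_trans (_ : \sum_(0 <= k < n) weight R k * B k <= C); last first.
  by near: n.
rewrite /= -sumrB; apply: le_trans (ler_norm_sum _ _ _) _.
apply: ler_sum => k _; rewrite -mulrBr normrM ger0_norm ?weight_ge0//.
by rewrite ler_wpM2l ?weight_ge0.
Unshelve. all: by end_near. Qed.

(* A draw below stage [j] lengthens the words by one letter; a draw from a later
   stage equalizes all words considered. *)
Lemma oscillation_le j i w w' : (i <= 4 ^ j)%N ->
  w \in ball (letters j) (4 ^ j - i) (map enum (iota 0 j)) ->
  w' \in ball (letters j) (4 ^ j - i) (map enum (iota 0 j)) ->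
  `|F w - F w'| <= (1 - 2 ^- j) ^+ i * (M + M) + 2 ^- j * M.
Proof.
have M0 : 0 <= M by apply: le_trans (f_le y0).
have j0 : 0 <= (2 : R) ^- j by rewrite invr_ge0 exprn_ge0.
elim: i w w' => [|i IH] w w' ij wW w'W.
  apply: le_trans (ler_normB _ _) _; rewrite expr0 mul1r.
  apply: (@le_trans _ _ (M + M)); first exact: lerD.
  by rewrite lerDl mulr_ge0.
set O := (1 - 2 ^- j) ^+ i * (M + M) + 2 ^- j * M in IH.
pose B k := if (k < j)%N then O else 2 ^- j * M.
apply: (@dist_le_series _ _ B) => [k|].
- rewrite /B; case: ifPn => [kj|].
    have H g : g \in stage k -> `|F (g * w)%g - F (g * w')%g| <= O.
      move=> /(stage_letters kj) gj; apply: IH; first exact: ltnW.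
        by rewrite -(subnSK ij) mem_ballS.
      by rewrite -(subnSK ij) mem_ballS.
    rewrite -avgB ler_norml; apply/andP; split.
      rewrite -[leLHS](avg_cst stage_gt0 k).
      by apply: ler_avg => g /H; rewrite ler_norml => /andP[].
    rewrite -[leRHS](avg_cst stage_gt0 k).
    by apply: ler_avg => g /H; rewrite ler_norml => /andP[].
  rewrite -leqNgt => jk.
  have sub : {subset ball (letters j) (4 ^ j - i.+1) (map enum (iota 0 j)) <=
      words k (letters k)}.
    by move=> g gb; apply: (sub_words jk); apply: sub_ball gb => //; exact: leq_subr.
  have /(_ f M f_le) := stage_equalizes (sub _ wW) (sub _ w'W).
  rewrite -mulrBl normrM normfV normr_nat ler_pdivrMr ?ltr0n ?stage_gt0//.
  under eq_bigr do rewrite -lactM; under [X in _ - X]eq_bigr do rewrite -lactM.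
  move=> /le_trans; apply; rewrite ler_wpM2r// ler_wpM2r//.
  by rewrite lef_pV2 ?posrE ?exprn_gt0// ler_eXn2l// ltr1n.
- near=> n; have jn : (j <= n)%N by near: n; exact: nbhs_infty_ge.
  rewrite (big_cat_nat (leq0n j) jn)//=.
  rewrite (eq_big_nat _ _ (F2 := fun k => weight R k * O)); last first.
    by move=> k /andP[_ kj]; rewrite /B kj.
  rewrite [X in _ + X](eq_big_nat _ _ (F2 := fun k => weight R k * (2 ^- j * M))); last first.
    by move=> k /andP[jk _]; rewrite /B ltnNge jk.
  rewrite -!mulr_suml sum_weight.
  have := sum_weight R n; rewrite (big_cat_nat (leq0n j) jn)//= sum_weight.
  set T := \sum_(j <= k < n) _ => TE.
  have TE' : T <= 2 ^- j.
    have : 0 <= (2 : R) ^- n by rewrite invr_ge0 exprn_ge0.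
    by lra.
  have : T * (2 ^- j * M) <= 2 ^- j * (2 ^- j * M).
    by apply: ler_wpM2r => //; rewrite mulr_ge0.
  (* The term [2 ^- j * M] of the bound reproduces itself: it is the fixed point of [O |-> (1 - 2 ^-
     j) * O + 2 ^- j * (2 ^- j * M)]. *)
  by rewrite /O exprS; set x := 2 ^- j; lra.
Unshelve. all: by end_near. Qed.
(** For [i = 4 ^ j] the words in [oscillation_le] shrink to the first [j] enumerated elements, which
    contain both given ones for large [j]; by [exp_decay] the bound is then at most
    [3 * M * 2 ^- j]. *)
Lemma harmonic_const w w' : F w = F w'.
Proof.
have M0 : 0 <= M by apply: le_trans (f_le y0).
have [k <-] := enum_surj w; have [k' <-] := enum_surj w'.
suff cv : (fun j => `|F (enum k) - F (enum k')|) @ \oo --> 0.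
  have : limn (fun=> `|F (enum k) - F (enum k')|) = 0 by exact: cvg_lim cv.
  rewrite (lim_cst (@Rhausdorff R)) => /eqP.
  by rewrite normr_eq0 subr_eq0 => /eqP.
apply: (@squeeze_cvgr _ _ _ _ (fun=> 0) (fun j => 2^-1 ^+ j * (3 * M))).
- near=> j; rewrite normr_ge0 /=.
  have kj : (maxn k k' < j)%N by near: j; exact: nbhs_infty_gt.
  have mem i : (i <= maxn k k')%N ->
      enum i \in ball (letters j) (4 ^ j - 4 ^ j) (map enum (iota 0 j)).
    by move=> ik; rewrite subnn /=; apply: map_f; rewrite mem_iota /=; exact: leq_ltn_trans kj.
  apply: le_trans (oscillation_le (leqnn _) (mem _ (leq_maxl _ _)) (mem _ (leq_maxr _ _))) _.
  have := ler_wpM2r (addr_ge0 M0 M0) (exp_decay j).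
  by rewrite exprVn; lra.
- exact: cvg_cst.
- rewrite -(mul0r (3 * M)); apply: cvgMl; apply: cvg_expr.
  by rewrite ger0_norm; lra.
Unshelve. all: by end_near. Qed.

End oscillation.

Lemma liouville_criterion : liouville R a.
Proof.
exists mu.
  (* Every element occurs in some stage, so the support is already the whole group. *)
  apply/seteqP; split => // g _ H [_ supH].
  have [k <-] := enum_surj g; apply: supH; apply: (@mixture_support _ _ _ _ k).
  exact: enum_stage.
move=> f [M fM] fh y z; have [w <-] := y0_orbit y; have [w' <-] := y0_orbit z.
exact: harmonic_const fM fh w w'.
Qed.

End criterion.

(** * Actions of sigma and tau on the dyadic numbers *)

Section order_action.
Context (R : realType) (G : groupType) (X : choiceType) (b : laction G X).
(** The coordinate [c] identifies [X] with the dyadic numbers, so that the dyadic points of the line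
    and, through the chart, those of the unit interval are treated at once. *)
Context (c : X -> R) (sg ta : G).
Hypothesis c_inj : injective c.
Hypothesis c_dyadic : forall x, dyadic (c x).
Hypothesis c_onto : forall r, dyadic r -> exists x, c x = r.
Hypothesis c_sigma : forall x, c (b sg x) = c x - 1.
Hypothesis c_tau : forall x, c (b ta x) =
  if c x <= 0 then c x else if c x <= 2 then c x / 2 else c x - 1.
Implicit Types (g h : G) (x y z : X) (m : int) (e xs : seq X).

Definition increasing g := forall x y, c x < c y -> c (b g x) < c (b g y).

Lemma lactK g : cancel (b g) (b g^-1%g).
Proof. by move=> x; rewrite -lactM mulVg lact1. Qed.

Lemma lactVK g : cancel (b g^-1%g) (b g).
Proof. by move=> x; rewrite -lactM mulgV lact1. Qed.

Lemma increasing1 : increasing 1%g.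
Proof. by move=> x y; rewrite !lact1. Qed.

Lemma increasingM g h : increasing g -> increasing h -> increasing (g * h)%g.
Proof. by move=> gi hi x y xy; rewrite !lactM; exact/gi/hi. Qed.

Lemma increasingV g : increasing g -> increasing g^-1%g.
Proof.
move=> gi x y xy; have [//|/gi|E] := ltrgtP (c (b g^-1%g x)) (c (b g^-1%g y)).
  by rewrite !lactVK; lra.
have := lactVK g x; rewrite (c_inj E) lactVK => yx.
by move: xy; rewrite yx ltxx.
Qed.

Lemma increasingX g n : increasing g -> increasing (g ^+ n)%g.
Proof.
move=> gi; elim: n => [|n IH]; first exact: increasing1.
by rewrite expgS; exact: increasingM.
Qed.

Lemma increasing_sigma : increasing sg.
Proof. by move=> x y; rewrite !c_sigma; lra. Qed.

Lemma increasing_tau : increasing ta.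
Proof. by move=> x y; rewrite !c_tau; repeat (case: ifPn => ?); lra. Qed.

(** Fixing a whole left half-line keeps the points already placed where they are while points
    further right are moved. *)
Definition fixes (r : R) g := forall x, c x <= r -> b g x = x.

Lemma fixesM r g h : fixes r g -> fixes r h -> fixes r (g * h)%g.
Proof. by move=> gr hr x xr; rewrite lactM hr// gr. Qed.

Lemma fixesV r g : fixes r g -> fixes r g^-1%g.
Proof. by move=> gr x xr; rewrite -{1}(gr x xr) lactK. Qed.

Lemma fixesX r g n : fixes r g -> fixes r (g ^+ n)%g.
Proof.
move=> gr; elim: n => [|n IH]; first by move=> x _; exact: lact1.
by rewrite expgS; exact: fixesM.
Qed.

Lemma fixesW r r' g : r' <= r -> fixes r g -> fixes r' g.
Proof. by move=> rr gr x xr; apply: gr; exact: le_trans xr _. Qed.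

(** * Translations, expansions and transitivity on increasing tuples *)

Lemma c_sigmaX n x : c (b (sg ^+ n)%g x) = c x - n%:R.
Proof.
elim: n x => [|n IH] x; first by rewrite lact1 subr0.
by rewrite expgS lactM c_sigma IH -natr1; lra.
Qed.

Lemma translation m : exists2 g, increasing g & forall x, c (b g x) = c x + m%:~R.
Proof.
have si n : increasing (sg ^+ n)%g by exact/increasingX/increasing_sigma.
case: m => n.
  exists (sg ^+ n)^-1%g; first exact: increasingV.
  by move=> x; have := c_sigmaX n (b (sg ^+ n)^-1%g x); rewrite lactVK => ->; rewrite subrK.
by exists (sg ^+ n.+1)%g => // x; rewrite c_sigmaX NegzE mulrNz.
Qed.

(** The inverse of [ta] conjugated by the translation by [m]. Its doubling clears denominators, and
    its unit shift moves integer points along. *)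
Lemma expansion m : exists g, [/\ increasing g, fixes m%:~R g,
  forall x, m%:~R <= c x -> c x <= m%:~R + 1 -> c (b g x) = 2 * c x - m%:~R &
  forall x, m%:~R + 1 <= c x -> c (b g x) = c x + 1].
Proof.
have [t ti tE] := translation m.
have tVE x : c (b t^-1%g x) = c x - m%:~R.
  by have := tE (b t^-1%g x); rewrite lactVK => ->; rewrite addrK.
(* With [y] the preimage under [ta], the cases of [c_tau] serve in place of a formula for the
   inverse. *)
have uE x : exists y, [/\ b (t * ta^-1 * t^-1)%g x = b t y,
    c x - m%:~R = c (b ta y) & c (b t y) = c y + m%:~R].
  exists (b ta^-1%g (b t^-1%g x)); split; first by rewrite !lactM.
    by rewrite lactVK tVE.
  by rewrite tE.
exists (t * ta^-1 * t^-1)%g; split.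
- apply: increasingM; last exact: increasingV.
  by apply: increasingM => //; exact/increasingV/increasing_tau.
- move=> x xm; apply: c_inj; have [y [-> + ->]] := uE x.
  by rewrite c_tau; repeat (case: ifPn => ?); lra.
- move=> x x1 x2; have [y [-> + ->]] := uE x.
  by rewrite c_tau; repeat (case: ifPn => ?); lra.
- move=> x x1; have [y [-> + ->]] := uE x.
  by rewrite c_tau; repeat (case: ifPn => ?); lra.
Qed.

(* Expanding at the integer part of [c x] halves the denominator of [c x]. *)
Lemma to_integer m x : m%:~R < c x -> exists g n,
  [/\ increasing g, fixes m%:~R g & c (b g x) = m%:~R + n.+1%:R].
Proof.
have [p [k xE]] := c_dyadic x; elim: k p x xE => [|k IH] p x xE mx.
  move: mx; rewrite xE expr0 divr1 ltr_int => mp.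
  have [n nE] : exists n : nat, p = m + n.+1%:R.
    exists (`|p - m|.-1)%N; have := mp; rewrite -subr_gt0.
    case: (p - m) (subrK m p) => // -[//|n] <- _ /=.
    by rewrite addrC natz.
  exists 1%g, n; split; [exact: increasing1|by move=> y _; exact: lact1|].
  by rewrite lact1 xE nE expr0 divr1 rmorphD/= rmorph_nat.
have [f0 f1] : (Num.floor (c x))%:~R <= c x /\ c x < (Num.floor (c x))%:~R + 1.
  by have := floor_itv (c x); rewrite rmorphD/= => /andP[].
have mf : (m%:~R : R) <= (Num.floor (c x))%:~R.
  by rewrite ler_int floor_ge_int ltW.
have [g [gi gm gE _]] := expansion (Num.floor (c x)).
have cgx := gE x f0 (ltW f1).
have [||h [n [hi hm hE]]] := IH (p - Num.floor (c x) * 2 ^+ k) (b g x).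
- rewrite cgx {1}xE exprS rmorphB rmorphM rmorphXn /=.
  have k0 : (2 : R) ^+ k != 0 by rewrite expf_neq0.
  by field.
- by rewrite cgx; lra.
exists (h * g)%g, n; split; first exact: increasingM.
  by apply: fixesM hm _; exact: fixesW mf gm.
by rewrite lactM.
Qed.

(** Once the point is at an integer, the inverse of the expansion at [m], which lowers every integer
    from [m + 2] on by one, is iterated until [m + 1] is reached. *)
Lemma to_next m x : m%:~R < c x -> exists g,
  [/\ increasing g, fixes m%:~R g & c (b g x) = m%:~R + 1].
Proof.
move=> /to_integer[g [n [gi gm gE]]]; have [d [di dm _ dE]] := expansion m.
have dVE y k : c y = m%:~R + k.+2%:R -> c (b d^-1%g y) = m%:~R + k.+1%:R.
  move=> yE; have [|z zE] := c_onto (_ : dyadic (m%:~R + k.+1%:R)).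
    by apply: dyadicD; [exact: dyadic_int|exact: dyadic_nat].
  suff -> : y = b d z by rewrite lactK.
  apply: c_inj; rewrite dE zE; first by rewrite yE -[k.+2%:R]natr1 addrA.
  by rewrite lerD2l ler1n.
exists (d^-1 ^+ n * g)%g; split.
- by apply: increasingM => //; exact/increasingX/increasingV.
- by apply: fixesM => //; exact/fixesX/fixesV.
rewrite lactM; elim: n (b g x) gE => [|n IH] y yE; first by rewrite lact1.
by rewrite expgSr lactM; apply: IH; exact: dVE.
Qed.

Local Notation sortedc := (sorted (relpre c <%R)).

(** The points are placed one by one from the left: the element treating the remaining ones fixes
    everything up to [m + 1], hence the point just placed. *)
Lemma to_successive m xs : path <%R m%:~R (map c xs) -> exists g,
  [/\ increasing g, fixes m%:~R g &
      [seq c (b g x) | x <- xs] = [seq m%:~R + i.+1%:R | i <- iota 0 (size xs)]].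
Proof.
have [n] := ubnP (size xs); elim: n xs m => // n IH [|x xs] m xsn.
  by move=> _; exists 1%g; split => //; [exact: increasing1|move=> y _; exact: lact1].
rewrite /= => /andP[mx xxs].
have [g [gi gm gE]] := to_next mx.
have [||h [hi hm hE]] := IH (map (b g) xs) (m + 1); first by rewrite size_map.
  rewrite rmorphD /= -gE -map_comp.
  by move: xxs; rewrite !path_map; apply: sub_path => y z; exact: gi.
exists (h * g)%g; split; first exact: increasingM.
  by apply: fixesM gm; apply: fixesW hm; rewrite rmorphD /=; lra.
rewrite lactM hm ?gE ?rmorphD//=; congr (_ :: _).
transitivity [seq c (b h y) | y <- map (b g) xs].
  by rewrite -map_comp; apply: eq_map => y /=; rewrite lactM.
rewrite hE size_map (iotaDl 1 0) -map_comp; apply: eq_map => i /=.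
by rewrite rmorphD/= add1n -[i.+2%:R]nat1r addrA.
Qed.

Lemma to_iota xs : sortedc xs -> exists2 g, increasing g &
  [seq c (b g x) | x <- xs] = [seq i%:R | i <- iota 0 (size xs)].
Proof.
case: xs => [|x xs] xxs; first by exists 1%g => //; exact: increasing1.
(* Subtracting 1 keeps the base strictly below [c x] even if [c x] is an integer; the first point
   then lands on the floor, which the translation below sends to 0. *)
have [|g [gi gm gE]] := @to_successive (Num.floor (c x) - 1) (x :: xs).
  move: xxs; rewrite /= path_map => ->; rewrite andbT.
  by have := floor_itv (c x); rewrite rmorphB rmorphD/= => /andP[]; lra.
have [t ti tE] := translation (- Num.floor (c x)).
exists (t * g)%g; first exact: increasingM.
transitivity [seq r + (- Num.floor (c x))%:~R | r <- [seq c (b g x) | x <- x :: xs]].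
  by rewrite -map_comp; apply: eq_map => y /=; rewrite lactM tE.
rewrite gE -map_comp; apply: eq_map => i /=.
by rewrite rmorphB rmorphN /= -natr1; lra.
Qed.

(** * Random draws that equalize points and decreasing lists *)

Lemma sort_seq xs : exists2 ys, sortedc ys & ys =i xs.
Proof.
exists (sort (relpre c <=%R) (undup xs)); last by move=> x; rewrite mem_sort mem_undup.
rewrite -sorted_map lt_sorted_uniq_le map_inj_uniq// sort_uniq undup_uniq/=.
by rewrite sorted_map sort_sorted// => x y; exact: le_total.
Qed.

Lemma exists_above xs : exists z, all (fun x => c x < c z) xs.
Proof.
elim: xs => [|x xs [z IH]]; first by have [z] := c_onto (dyadic_nat 0); exists z.
have [w wE] := c_onto (dyadicD (c_dyadic x) (dyadic_nat 1)).
have [xz|zx] := ltP (c x) (c z); first by exists z; rewrite /= xz.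
exists w; rewrite /= wE; apply/andP; split; first lra.
by apply: sub_all IH => y yz; lra.
Qed.

Lemma exists_below xs : exists z, all (fun x => c z < c x) xs.
Proof.
elim: xs => [|x xs [z IH]]; first by have [z] := c_onto (dyadic_nat 0); exists z.
have [w wE] := c_onto (dyadicB (c_dyadic x) (dyadic_nat 1)).
have [xz|zx] := ltP (c z) (c x); first by exists z; rewrite /= xz.
exists w; rewrite /= wE; apply/andP; split; first lra.
by apply: sub_all IH => y yz; lra.
Qed.

(** The Folner estimate for intervals of integers: each unit shift exchanges one term at either end,
    at cost [2 * M]. *)
Lemma sum_shift (phi : nat -> R) M N d : (forall t, `|phi t| <= M) ->
  `|\sum_(t <- iota 0 N) phi t - \sum_(t <- iota 0 N) phi (t + d)%N| <= 2 * d%:R * M.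
Proof.
move=> phiM; elim: d => [|d IH].
  rewrite [X in _ - X](_ : _ = \sum_(t <- iota 0 N) phi t); last first.
    by apply: eq_bigr => t _; rewrite addn0.
  by rewrite subrr normr0 mulr0 mul0r.
have E : \sum_(t <- iota 0 N) phi (t + d)%N - \sum_(t <- iota 0 N) phi (t + d.+1)%N =
    phi d - phi (N + d)%N.
  elim: N {IH} => [|N IH]; first by rewrite !big_nil subrr add0n subrr.
  by rewrite -addn1 iotaD !big_cat !big_seq1 /= add0n addnS addn1; lra.
have -> : \sum_(t <- iota 0 N) phi t - \sum_(t <- iota 0 N) phi (t + d.+1)%N =
  (\sum_(t <- iota 0 N) phi t - \sum_(t <- iota 0 N) phi (t + d)%N) + (phi d - phi (N + d)%N).
  by rewrite -E; ring.
apply: le_trans (ler_normD _ _) _; apply: le_trans (lerD IH (ler_normB _ _)) _.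
by rewrite -natr1; have := phiM d; have := phiM (N + d)%N; lra.
Qed.

(** All points of [xs] lie on one forward orbit of a suitable [h], so exchanging two of them in a
    random power of [h] only shifts the exponent, by less than the number of distinct points. *)
Lemma equalize_above z xs eps : 0 < eps -> all (fun x => c z < c x) xs ->
  exists s, [/\ (0 < size s)%N, {in s, forall g, increasing g /\ fixes (c z) g} &
    {in xs &, forall x y (psi : X -> R) (M : R), (forall v, `|psi v| <= M) ->
      `|\sum_(g <- s) psi (b g x) - \sum_(g <- s) psi (b g y)| <= eps * M * (size s)%:R}].
Proof.
move=> e0 zxs; have [ys ys_sorted ysE] := sort_seq xs.
have [|u ui uE] := @to_iota (z :: ys).
  rewrite /= path_min_sorted//; apply/allP => y; rewrite ysE => yxs.
  exact: (allP zxs).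
move: uE; rewrite /= => -[uz uys].
have := expansion 0; rewrite mulr0z add0r => -[d [di d0 _ dE]].
(* In the coordinate given by [u], where [z] is 0 and the sorted points are 1, 2 and so on, the
   expansion at 0 fixes the left and moves each point to the next. *)
pose h := (u^-1 * d * u)%g.
have hi : increasing h.
  by apply: increasingM => //; apply: increasingM => //; exact: increasingV.
have hz : fixes (c z) h.
  move=> x xz; rewrite /h !lactM d0 ?lactK//.
  by move: xz; rewrite le_eqVlt => /predU1P[/c_inj->|/ui]; rewrite uz// => /ltW.
have hX n x i : c (b u x) = i.+1%:R -> c (b u (b (h ^+ n)%g x)) = (i + n).+1%:R.
  move=> xE; elim: n => [|n IH]; first by rewrite lact1 addn0.
  rewrite expgS lactM /h !lactM lactVK dE IH ?addnS ?natr1//.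
  by rewrite ler1n.
have idx x : x \in xs -> exists2 i, (i < size ys)%N & c (b u x) = i.+1%:R.
  rewrite -ysE => xys; have : c (b u x) \in [seq c (b u x) | x <- ys].
    exact: map_f.
  rewrite uys => /mapP[[|i]]; rewrite mem_iota// add1n ltnS => /andP[_ iys] ->.
  by exists i.
have [N N0 e2] : exists2 N, (0 < N)%N & 2 * (size ys)%:R <= N%:R * eps.
  have r0 : 0 <= 2 * (size ys)%:R / eps by rewrite divr_ge0 ?mulr_ge0// ltW.
  exists (Num.truncn (2 * (size ys)%:R / eps)).+1 => //.
  by rewrite -ler_pdivrMr//; apply/ltW; have /andP[] := truncn_itv r0.
exists [seq (h ^+ t)%g | t <- iota 0 N]; split; first by rewrite size_map size_iota.
  by move=> _ /mapP[t _ ->]; split; [exact: increasingX|exact: fixesX].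
suff H x y i j : c (b u x) = i.+1%:R -> c (b u y) = j.+1%:R -> (i <= j)%N ->
    (j < size ys)%N -> forall (psi : X -> R) (M : R), (forall v, `|psi v| <= M) ->
    `|\sum_(t <- iota 0 N) psi (b (h ^+ t)%g x) -
      \sum_(t <- iota 0 N) psi (b (h ^+ t)%g y)| <= eps * M * N%:R.
  move=> x y /idx[i iys xi] /idx[j jys yj] psi M psiM.
  rewrite !big_map size_map size_iota.
  have [ij|/ltnW ji] := leqP i j; first exact: H xi yj ij jys _ _ psiM.
  by rewrite distrC; exact: H yj xi ji iys _ _ psiM.
move=> xi yj ij jys psi M psiM.
have M0 : 0 <= M by apply: le_trans (psiM z).
have -> : y = b (h ^+ (j - i))%g x.
  by apply: (lact_inj (a := b) (g := u)); apply: c_inj; rewrite (hX _ _ i)// subnKC.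
under [X in _ - X]eq_bigr => t _ do rewrite -lactM -expgnDr.
apply: le_trans (@sum_shift (fun t => psi (b (h ^+ t)%g x)) M N (j - i) _) _ => //.
have : 2 * (size ys)%:R * M <= N%:R * eps * M by rewrite ler_wpM2r.
have : (j - i)%:R * M <= (size ys)%:R * M.
  by rewrite ler_wpM2r// ler_nat; apply: leq_trans (leq_subr _ _) (ltnW jys).
by lra.
Qed.

(** The estimate is made conditionally on [g'] and then summed. *)
Lemma sum_allpairs_dist (s s' : seq G) (phi psi : G -> G -> R) C :
  (forall g', g' \in s' -> `|\sum_(g <- s) phi g g' - \sum_(g <- s) psi g g'| <= C) ->
  `|\sum_(g <- s) \sum_(g' <- s') phi g g' - \sum_(g <- s) \sum_(g' <- s') psi g g'|
    <= C * (size s')%:R.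
Proof.
move=> H; rewrite exchange_big [X in _ - X]exchange_big /= -sumrB big_seq.
apply: le_trans (ler_norm_sum _ _ _) _.
apply: (@le_trans _ _ (\sum_(g' <- s' | g' \in s') C)); first exact: ler_sum.
by rewrite -big_seq big_const_seq count_predT iter_addr addr0 mulr_natr.
Qed.

(* If [p] lies to the left of [z] the last factor [h] of [g = h * g'] forgets [q];
   otherwise [g'], obtained with [x] in the role of [z], already does. *)
Lemma equalize_head z xs eps : 0 < eps -> sortedc (z :: xs) ->
  exists s, [/\ (0 < size s)%N, {in s, forall g, increasing g /\ fixes (c z) g} &
    forall (p : seq X) q q', q \in xs -> q' \in xs ->
      (forall x, x \in p -> [/\ c x <= c z \/ x \in xs, c x < c q & c x < c q']) ->
      forall (phi : seq X -> R) (M : R), (forall l, `|phi l| <= M) ->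
      `|\sum_(g <- s) phi (map (b g) (q :: p)) - \sum_(g <- s) phi (map (b g) (q' :: p))|
        <= eps * M * (size s)%:R].
Proof.
move=> e0; elim: xs z => [|x xs IH] z.
  move=> _; exists [:: 1%g]; split => // g; rewrite inE => /eqP ->.
  by split; [exact: increasing1|move=> ? _; exact: lact1].
move=> zxxs; have zx : c z < c x by case/andP: zxxs.
have xxs : sortedc (x :: xs) by case/andP: zxxs.
have [s' [s'0 s'P s'E]] := IH _ xxs.
have x_le q : q \in x :: xs -> c x <= c q.
  rewrite inE => /predU1P[->//|qxs]; apply/ltW.
  have : {in xs, forall y, relpre c <%R x y}.
    by apply/allP; apply: order_path_min xxs => ? ? ? /=; exact: lt_trans.
  by move=> /(_ _ qxs).
(* The positions to which the first draw can bring a point of [x :: xs]; they stay to the right of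
   [z] because that draw preserves order and fixes [z]. *)
pose P := [seq b g y | g <- s', y <- x :: xs].
have zP : all (fun y => c z < c y) P.
  apply/allP => _ /allpairsP[[g y] /= [gs /x_le xy ->]].
  have [gi gx] := s'P _ gs; rewrite -(gx z (ltW zx)); apply: gi.
  exact: lt_le_trans xy.
have [s [s0 sP sE]] := equalize_above e0 zP.
exists [seq (g * g')%g | g <- s, g' <- s']; split.
- by rewrite size_allpairs muln_gt0 s0.
- move=> _ /allpairsP[[g g'] /= [/sP[gi gz] /s'P[gi' gx'] ->]].
  split; first exact: increasingM.
  by apply: fixesM => //; apply: fixesW gx'; exact: ltW.
move=> p q q' qxs q'xs pP phi M phiM.
rewrite !big_allpairs_dep size_allpairs natrM mulrA.
have mapM g g' l : map (b (g * g')%g) l = map (b g) (map (b g') l).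
  by rewrite -map_comp; apply: eq_map => y /=; rewrite lactM.
have [/allP pz|/allPn[y yp yz]] := boolP (all (fun y => c y <= c z) p).
  apply: sum_allpairs_dist => g' g's.
  have [_ gx'] := s'P _ g's.
  have mapp g : g \in s -> forall r, map (b (g * g')%g) (r :: p) = b g (b g' r) :: p.
    move=> /sP[_ gz] r /=; rewrite lactM; congr (_ :: _).
    rewrite -[RHS]map_id; apply/eq_in_map => y /pz yz.
    by rewrite lactM gx' ?gz//; apply: le_trans yz (ltW zx).
  have E r : \sum_(g <- s) phi (map (b (g * g')%g) (r :: p)) =
      \sum_(g <- s) phi (b g (b g' r) :: p).
    by rewrite big_seq [RHS]big_seq; apply: eq_bigr => g /mapp ->.
  rewrite !E; apply: (sE _ _ _ _ (fun r => phi (r :: p))) => //.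
    exact: (allpairs_f (fun g y => b g y)).
  exact: (allpairs_f (fun g y => b g y)).
(* A point [y] of [p] to the right of [z] is at least [x], so [q] and [q'], being beyond [y], belong
   to [xs] and the induction hypothesis applies. *)
have yxxs : y \in x :: xs.
  by have [[yz'|//] _ _] := pP _ yp; rewrite yz' in yz.
have tail r : r \in x :: xs -> c y < c r -> r \in xs.
  rewrite inE => /predU1P[-> yx|//]; by have := x_le _ yxxs; rewrite leNgt yx.
have [_ yq yq'] := pP _ yp.
rewrite mulrAC -sumrB.
apply: le_trans (ler_norm_sum _ _ _) _.
rewrite [leRHS]mulr_natr -[_ *+ _]addr0 -iter_addr -(count_predT s) -big_const_seq.
apply: ler_sum => g _.
under eq_bigr do rewrite mapM; under [X in _ - X]eq_bigr do rewrite mapM.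
apply: (s'E p q q' _ _ _ (fun l => phi (map (b g) l))) => //; [exact: tail|exact: tail|].
move=> r rp; have [rz rq rq'] := pP _ rp; split => //.
case: rz => [rz|]; first by left; apply: le_trans rz (ltW zx).
by rewrite inE => /predU1P[->|->]; [left|right].
Qed.

Local Notation decreasingc := (sorted (fun x y => c y < c x)).

(** Lists decrease so that the head is the largest point. Three errors of [eps / 3] add up: the head
    of [e] is replaced by a common point, the tails are exchanged by induction, and the head of [e']
    is put back. *)
Lemma equalize_configurations n (E : seq (seq X)) eps : 0 < eps ->
  (forall e, e \in E -> decreasingc e /\ size e = n) ->
  exists s, [/\ (0 < size s)%N, {in s, forall g, increasing g} &
    {in E &, forall e e' (phi : seq X -> R) (M : R), (forall l, `|phi l| <= M) ->
      `|\sum_(g <- s) phi (map (b g) e) - \sum_(g <- s) phi (map (b g) e')|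
        <= eps * M * (size s)%:R}].
Proof.
elim: n E eps => [|n IH] E eps e0 EP.
  exists [:: 1%g]; split => //.
    by move=> g; rewrite inE => /eqP ->; exact: increasing1.
  move=> e e' /EP[_ /size0nil ->] /EP[_ /size0nil ->] phi M phiM.
  have M0 : 0 <= M by apply: le_trans (phiM [::]).
  by rewrite subrr normr0 !mulr_ge0// ltW.
have e3 : 0 < eps / 3 by rewrite divr_gt0.
have [|s [s0 sP sE]] := IH (map behead E) _ e3.
  move=> _ /mapP[e /EP[+ +] ->]; case: e => [|x e] //= /path_sorted + [].
  by [].
pose P := [seq b g x | g <- s, x <- flatten E].
(* The common substitute for the largest point, above every position reached by the first draw. *)
have [w wP] := exists_above P.
have [z zP] := exists_below (w :: P).
have [xs xs_sorted xsE] := sort_seq (w :: P).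
have [|s' [s'0 s'P s'E]] := @equalize_head z xs _ e3.
  rewrite /= path_min_sorted//; apply/allP => y; rewrite xsE => yP.
  exact: (allP zP).
exists [seq (g' * g)%g | g' <- s', g <- s]; split.
- by rewrite size_allpairs muln_gt0 s0 s'0.
- by move=> _ /allpairsP[[g' g] /= [/s'P[gi' _] /sP gi ->]]; exact: increasingM.
move=> e e' eE e'E phi M phiM.
have mapM g g' l : map (b (g * g')%g) l = map (b g) (map (b g') l).
  by rewrite -map_comp; apply: eq_map => y /=; rewrite lactM.
(* The test function for the tails, averaged over the second draw with the head set to [w]; its
   bound carries the factor [size s'] since the sum is not normalized. *)
pose F l := \sum_(g' <- s') phi (map (b g') (w :: l)).
have FM l : `|F l| <= M * (size s')%:R.
  apply: le_trans (ler_norm_sum _ _ _) _.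
  rewrite mulr_natr -[_ *+ _]addr0 -iter_addr -(count_predT s') -big_const_seq.
  exact: ler_sum.
have step d : d \in E ->
    `|\sum_(g' <- s') \sum_(g <- s) phi (map (b (g' * g)%g) d) -
      \sum_(g <- s) F (map (b g) (behead d))| <= eps / 3 * M * (size s')%:R * (size s)%:R.
  move=> dE; rewrite /F [X in _ - X]exchange_big /=.
  apply: sum_allpairs_dist => g gs.
  under eq_bigr do rewrite mapM.
  have [] := EP _ dE; case: d dE => [//|x d] dE dd _.
  have mP y : y \in x :: d -> b g y \in P.
    move=> yd; apply: (allpairs_f (fun g y => b g y)) => //.
    by apply/flattenP; exists (x :: d).
  apply: s'E => //.
  - by rewrite xsE inE mP ?orbT// mem_head.
  - by rewrite xsE mem_head.
  move=> _ /mapP[y yd ->]; split.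
  - by right; rewrite xsE inE mP ?orbT// inE yd orbT.
  - apply: sP => //; have : {in d, forall y, c y < c x}.
      apply/allP; apply: (order_path_min _ dd) => ? ? ? /= h1 h2.
      exact: lt_trans h2 h1.
    exact.
  - by apply: (allP wP); apply: mP; rewrite inE yd orbT.
rewrite !big_allpairs_dep size_allpairs natrM.
have := step _ eE; have := step _ e'E.
have := sE _ _ (map_f behead eE) (map_f behead e'E) F _ FM.
set A := \sum_(g <- s) F _; set A' := \sum_(g <- s) F _.
set B := \sum_(g' <- s') _; set B' := \sum_(g' <- s') _.
rewrite !ler_norml => /andP[? ?] /andP[? ?] /andP[? ?]; apply/andP; split; lra.
Qed.

(** * Finite subsets as decreasing lists *)

Lemma nsubsets_seq (T : choiceType) (s : seq T) : uniq s -> nsubsets (size s) [set` s].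
Proof.
move=> us; rewrite /nsubsets /= (_ : [set` s] = [set` [fset x in s]%fset]).
  by apply/card_eq_fsetP; rewrite card_fseq undup_id.
by apply/seteqP; split => x /=; rewrite !inE.
Qed.

Lemma image_seq (T U : eqType) (f : T -> U) (s : seq T) : f @` [set` s] = [set` map f s].
Proof.
apply/seteqP; split => [_ [x xs <-]|y /= /mapP[x xs ->]]; last by exists x.
exact: map_f.
Qed.

Lemma decreasing_uniq e : decreasingc e -> uniq e.
Proof.
apply: sorted_uniq => [? ? ? /= h1 h2|x]; last by rewrite /= ltxx.
exact: lt_trans h2 h1.
Qed.

Lemma nsubsets_configuration n (B : set X) : nsubsets n B ->
  exists2 e, decreasingc e /\ size e = n & B = [set` e].
Proof.
move=> Bn; have /finite_seqP[s sB] : finite_set B by exists n.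
have [ys ys_sorted ysE] := sort_seq s.
have Be : B = [set` rev ys].
  by rewrite sB; apply/seteqP; split => x /=; rewrite mem_rev ysE.
have dys : decreasingc (rev ys) by rewrite rev_sorted.
exists (rev ys) => //; split => //; apply/card_eq_II.
apply: card_eq_trans Bn; rewrite card_eq_sym Be.
exact: nsubsets_seq (decreasing_uniq dys).
Qed.

Lemma exists_configuration n : exists2 e, decreasingc e & size e = n.
Proof.
elim: n => [|n [e ed en]]; first by exists [::].
have [z zP] := exists_above e; exists (z :: e); last by rewrite /= en.
by rewrite /= path_min_sorted.
Qed.

(** Both lists, reversed, can be moved to the same initial integers by [to_iota]. This yields
    transitivity on subsets of a given size. *)
Lemma configuration_orbit e e' : decreasingc e -> decreasingc e' -> size e = size e' ->
  exists g, map (b g) e = e'.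
Proof.
move=> ed ed' ee.
have /to_iota[g _ gE] : sortedc (rev e) by rewrite rev_sorted.
have /to_iota[h _ hE] : sortedc (rev e') by rewrite rev_sorted.
exists (h^-1 * g)%g; apply: (inj_map (lact_inj (a := b) (g := h))); apply: (inj_map c_inj).
apply: (can_inj revK); rewrite -!map_comp -!map_rev hE size_rev -ee -size_rev -gE.
by apply: eq_map => x /=; rewrite lactM lactVK.
Qed.

Lemma liouville_nsubsets n : countable [set: G] -> liouville R (nsubsets_laction b n).
Proof.
case/countable_injP => code code_inj.
(* An enumeration of the group that inverts [code], with the value 1 outside its range. *)
have /choice[enum enumP] : forall k, exists h, forall g, code g = k -> h = g.
  move=> k; have [[g gk]|nk] := pselect (exists g, code g = k).
    by exists g => h hk; apply: code_inj; rewrite ?in_setT// gk hk.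
  by exists 1%g => h hk; case: nk; exists h.
have [e0 e0d e0n] := exists_configuration n.
have e0P : nsubsets n [set` e0] by rewrite -e0n; exact/nsubsets_seq/decreasing_uniq.
pose y0 : nsubsets (X := X) n := exist _ [set` e0] (mem_set e0P).
apply: (@liouville_criterion _ _ _ _ enum y0).
- by move=> g; exists (code g); exact: enumP.
- move=> y; have [e [ed en] ye] := nsubsets_configuration (set_mem (valP y)).
  have [g ge] := configuration_orbit e0d ed (etrans e0n (esym en)).
  by exists g; apply: val_inj; rewrite /= /set_lact image_seq ge.
move=> W eps eps0.
have /choice[e eP] : forall w, exists e, [/\ decreasingc e, size e = n &
    b w @` [set` e0] = [set` e]].
  move=> w; have := @nsubsets_invariant _ _ b n w _ e0P.
  by move=> /nsubsets_configuration[e [ed en] eE]; exists e.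
have [|s [s0 _ sE]] := @equalize_configurations n (map e W) _ eps0.
  by move=> _ /mapP[w _ ->]; have [] := eP w.
exists s => // w w' wW w'W f M fM.
(* The function [f] read on lists, with default value 0 when the entries do not form an
   [n]-subset. *)
pose phi (l : seq X) := if pselect (nsubsets n [set` l]) is left lP
  then f (exist _ [set` l] (mem_set lP)) else 0.
have M0 : 0 <= M by apply: le_trans (fM y0).
have phiE g v : phi (map (b g) (e v)) = f (nsubsets_laction b n g (nsubsets_laction b n v y0)).
  have [_ _ vE] := eP v.
  have E : [set` map (b g) (e v)] = val (nsubsets_laction b n g (nsubsets_laction b n v y0)).
    by rewrite /= /set_lact vE image_seq.
  rewrite /phi; case: pselect => [lP|[]]; first by congr f; apply: val_inj.
  by rewrite E; exact: set_mem (valP _).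
under eq_bigr do rewrite -phiE; under [X in _ - X]eq_bigr do rewrite -phiE.
apply: sE; [exact: map_f|exact: map_f|].
by move=> l; rewrite /phi; case: pselect => // _; rewrite normr0.
Qed.

End order_action.

(** * Countability of Thompson's group *)

Section thompson_countable.
Context (R : realType).
Implicit Types (f g : thompson R) (p q x y : R) (s t : seq R).

(** Relative to an interval, so that an induction on the possibly unsorted list [s] can cut the
    interval at its entries. *)
Definition affine_off (f : R -> R) s p q := forall p' q', p <= p' -> p' < q' -> q' <= q ->
  {in s, forall b, ~~ (p' < b < q')} -> pow2_affine f p' q'.

Lemma pow2_affine_eq (f g : R -> R) p q x : pow2_affine f p q -> pow2_affine g p q ->
  f p = g p -> f q = g q -> p <= x <= q -> f x = g x.
Proof.
move=> [k [u fE]] [l [v gE]] fgp fgq xpq; have /andP[px xq] := xpq.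
have [pq|qp] := ltP p q; last by rewrite (_ : x = p)//; lra.
move: fgp fgq; rewrite !fE ?gE ?lexx ?(ltW pq)// => fgp fgq.
have : (2 ^ k - 2 ^ l) * (q - p) = 0 :> R by lra.
move/eqP; rewrite mulf_eq0 subr_eq0 => /orP[/eqP E|]; last by rewrite subr_eq0 gt_eqF.
by move: fgp; rewrite E; lra.
Qed.

Lemma affine_off_cons (f : R -> R) b s p q p' q' : affine_off f (b :: s) p q ->
  p <= p' -> q' <= q -> ~~ (p' < b < q') -> affine_off f s p' q'.
Proof.
move=> fa pp qq nb p1 q1 pp1 pq1 qq1 h; apply: fa => //; [lra|lra|].
move=> z; rewrite inE => /predU1P[->|/h//]; apply: contra nb => /andP[? ?].
by apply/andP; split; lra.
Qed.

(** Induction on [s]: an entry inside the interval cuts it in two, any other is dropped, and with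
    none left the endpoint values determine an affine function. *)
Lemma affine_off_eq (f g : R -> R) s p q x :
  affine_off f s p q -> affine_off g s p q -> {in s, f =1 g} ->
  f p = g p -> f q = g q -> p <= x <= q -> f x = g x.
Proof.
elim: s p q => [|b s IH] p q fa ga fg fgp fgq xpq; have /andP[px xq] := xpq.
  have [pq|qp] := ltP p q; last by rewrite (_ : x = p)//; lra.
  by apply: (@pow2_affine_eq _ _ p q) => //; [apply: fa|apply: ga].
have fgs : {in s, f =1 g} by move=> y ys; apply: fg; rewrite inE ys orbT.
have fgb : f b = g b by apply: fg; exact: mem_head.
have [/andP[pb bq]|nb] := boolP (p < b < q); last first.
  by apply: (IH p q) => //;
    [exact: affine_off_cons fa _ _ nb|exact: affine_off_cons ga _ _ nb].
have [xb|bx] := leP x b.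
  have nb : ~~ (p < b < b) by rewrite ltxx andbF.
  by apply: (IH p b); rewrite ?px//;
    [apply: affine_off_cons fa _ _ nb|apply: affine_off_cons ga _ _ nb];
    rewrite ?lexx ?ltW.
have nb : ~~ (b < b < q) by rewrite ltxx.
by apply: (IH b q); rewrite ?xq ?ltW//;
  [apply: affine_off_cons fa _ _ nb|apply: affine_off_cons ga _ _ nb];
  rewrite ?lexx ?ltW.
Qed.

(** An element is determined by its values at finitely many dyadic numbers, and these values are
    dyadic, so a finite list of pairs of dyadic fractions encodes it. *)
Lemma countable_thompson : countable [set: thompson R].
Proof.
pose dec (u : int * nat) : R := u.1%:~R / 2 ^+ u.2.
have /choice[enc encP] : forall x, exists u, dyadic x -> dec u = x.
  move=> x; have [[m [k xE]]|nx] := pselect (dyadic x); last by exists (0, 0%N).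
  by exists (m, k).
pose codes f (L : seq ((int * nat) * (int * nat))) :=
  affine_off f [seq dec u.1 | u <- L] 0 1 /\ forall u, u \in L -> f (dec u.1) = dec u.2.
have /choice[code codeP] : forall f, exists L, codes f L.
  move=> f; have [_ _ [s sd sf]] := thompsonP f.
  exists [seq (enc b, enc (f b)) | b <- s]; split.
    rewrite -map_comp (_ : map _ s = s) //.
    by rewrite -[RHS]map_id; apply/eq_in_map => b /sd /encP.
  move=> _ /mapP[b /sd bd ->] /=; rewrite !encP//.
  exact: thompson_dyadic (thompsonP f) bd.
have code_inj : injective code.
  move=> f g fg; apply: thompson_ext => x.
  have [_ fid _] := thompsonP f; have [_ gid _] := thompsonP g.
  have [x01|x01] := boolP (0 < x < 1); last by rewrite fid// gid.
  have [fa fL] := codeP f; have [ga gL] := codeP g; rewrite -fg in ga gL.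
  apply: (affine_off_eq fa ga).
  - by move=> _ /mapP[u uL ->]; rewrite fL// gL.
  - by rewrite fid ?gid// ltxx.
  - by rewrite fid ?gid// ltxx andbF.
  - by move: x01 => /andP[? ?]; apply/andP; split; exact: ltW.
apply/countable_injP; exists (choice.pickle \o code) => f g _ _ /=.
by move=> /(pcan_inj choice.pickleK)/code_inj.
Qed.

End thompson_countable.

(** * The two actions in dyadic coordinates *)

Theorem corollary6p4 (R : realType) (n : nat) :
  (forall (a : laction (thompson R) R) (ha : standard_line_action a),
     liouville R (nsubsets_laction (restr_laction (line_dyadic ha)) n)) /\
  liouville R (nsubsets_laction (restr_laction (unit_dyadic_invariant (R := R))) n).
Proof.
split.
  move=> a ha; have [_ asigma atau _] := ha.
  apply: (@liouville_nsubsets _ _ _ _ (fun x : @dyadic R => val x) (sigma R) (tau R)).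
  - exact: val_inj.
  - by move=> x; exact: set_mem (valP x).
  - by move=> r rd; exists (exist _ r (mem_set rd)).
  - by move=> x; exact: asigma.
  - by move=> x; exact: atau.
  - exact: countable_thompson.
(* On the unit interval the coordinate is the inverse of the chart, which conjugates [sigma] and
   [tau] to their formulas on the line. *)
have /choice[h hP] := @chart_surj R.
have chart_inj : injective (@chart R).
  by apply: inc_inj; apply: le_mono; exact: chart_inc.
have hK (x : @unit_dyadic R) : chart (h (val x)) = val x /\ dyadic (h (val x)).
  have [x01 xd] := set_mem (valP x).
  have [] := hP (val x); first by move: x01; rewrite /= in_itv.
  by move=> -> /(_ xd).
apply: (@liouville_nsubsets _ _ _ _ (fun x : @unit_dyadic R => h (val x)) (sigma R) (tau R)).
- by move=> x y E; apply: val_inj; have [<- _] := hK x; have [<- _] := hK y; rewrite E.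
- by move=> x; have [] := hK x.
- move=> r rd.
  have rP : unit_dyadic (chart r).
    by split; [rewrite /= in_itv /=; exact: chart_itv|exact: chart_dyadic].
  pose y : unit_dyadic (R := R) := exist _ (chart r) (mem_set rP).
  by exists y; apply: chart_inj; have [->] := hK y.
- move=> x; apply: chart_inj; rewrite (hK _).1 -chart_sigma (hK _).1.
  by [].
- move=> x; apply: chart_inj; rewrite (hK _).1 -chart_tau (hK _).1.
  by [].
- exact: countable_thompson.
Qed.
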